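(* Let $\mathcal{S}$ be the collection of all pairs $(f,\eta)$ that satisfy conditions (a)-(d) of the context. If $$\beta(2\alpha-d)\le 2\alpha,$$ then $$\inf_{g}\ \sup_{(f,\eta)\in\mathcal{S}}(R-R^* )=\Omega\left(N^{-\min\left\{\beta,\ \frac{2\beta(\alpha+1)}{\beta d+2(\alpha+2\beta)}\right\}}\right),$$ where the infimum is over all classifiers $g$ built from the $N$ training samples (including those that do not use nearest neighbor distances) that do not have knowledge of the underlying regression function $\eta$.
   Context: Classification setting. $(\mathbf{X},Y)$ takes values in $\mathbb{R}^d\times\{-1,1\}$; $\mathbf{X}$ has probability density $f$, and $\eta(\mathbf{x}):=\mathbb{E}[Y|\mathbf{X}=\mathbf{x}]$. A classifier $g$ is built from $N$ i.i.d. training samples $(\mathbf{X}_i,Y_i)$, $i=1,\dots,N$, with the law of $(\mathbf{X},Y)$, independent of the test pair $(\mathbf{X},Y)$. Its risk is $R=\mathrm{P}(g(\mathbf{X})\neq Y)$ (probability over the training samples and the test pair). The Bayes classifier is $g^*(\mathbf{x})=\operatorname{sign}(\eta(\mathbf{x}))$, with Bayes risk $R^*=\mathrm{P}(g^*(\mathbf{X})\ne Y)$; the excess risk is $R-R^*=\mathbb{E}[\mathbf{1}(g(\mathbf{X})\neq g^*(\mathbf{X}))|\eta(\mathbf{X})|]$. Let $\|\cdot\|$ be any fixed norm on $\mathbb{R}^d$. $B(\mathbf{x},r)$ is the ball with center $\mathbf{x}$ and radius $r$ in this norm, $V(\cdot)$ denotes volume, and $\mathrm{P}(B(\mathbf{x},r))$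 is the probability mass of $B(\mathbf{x},r)$ under the law of $\mathbf{X}$. Conditions on $(f,\eta)$: there exist finite constants $C_a,C_b,C_c$, a constant $C_d>0$, and $\alpha>0$, $\beta>0$ such that (a) for all $t>0$, $\mathrm{P}(0<|\eta(\mathbf{X})|\le t)\le C_at^\alpha$; (b) for all $t>0$, $\mathrm{P}(f(\mathbf{X})\le t)\le C_bt^\beta$; (c) for every $r>0$ and every $\mathbf{x}$ in the support of $f$, $|\eta(B(\mathbf{x},r))-\eta(\mathbf{x})|\le C_cr^2$, where $\eta(B(\mathbf{x},r)):=\mathbb{E}[Y|\mathbf{X}\in B(\mathbf{x},r)]$; (d) there is $D>0$ such that $\mathrm{P}(B(\mathbf{x},r))\ge C_df(\mathbf{x})V(B(\mathbf{x},r))$ for all $\mathbf{x}$ and all $0<r<D$. $\Omega$ is with respect to $N\to\infty$, with constant not depending on $N$. *)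

(* Defs.v *)
(* MathComp-Analysis *)
From HB Require Import structures.
From mathcomp Require Import all_boot all_order all_algebra.
From mathcomp Require Import all_classical all_reals all_analysis.

Set Implicit Arguments.
Unset Strict Implicit.
Unset Printing Implicit Defensive.
Import Order.TTheory GRing.Theory Num.Theory.
Import numFieldNormedType.Exports.

Local Open Scope classical_set_scope.
Local Open Scope ring_scope.

(** ** Finite powers of a sigma-finite measure *)

Section power_measure.
Context {R : realType} {d0 : measure_display} {T : measurableType d0}.

Definition cons_tup (n : nat) (p : T * n.-tuple T) : n.+1.-tuple T :=
  [tuple of p.1 :: p.2].

Lemma measurable_cons_tup n : measurable_fun [set: T * n.-tuple T] (@cons_tup n).
Proof. exact: measurable_cons measurable_fst measurable_snd. Qed.

Section step.
Context {n : nat} (mu : {sigma_finite_measure set T -> \bar R})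
  (nu : {sigma_finite_measure set (n.-tuple T) -> \bar R}).

Definition cons_measure : set (n.+1.-tuple T) -> \bar R :=
  pushforward (mu \x nu)%E (@cons_tup n).

HB.instance Definition _ := Measure.copy cons_measure
  (@measure_function_pushforward__canonical__measure_function_Measure
    _ _ _ _ _ (mu \x nu)%E _ (@measurable_cons_tup n)).

Lemma cons_measure_sigma_finite : sigma_finite setT cons_measure.
Proof.
have [F FT mF] : sigma_finite setT (mu \x nu)%E.
  have /sigma_finiteP[A [TA ndA Aoo]] := sigma_finiteT mu.
  have /sigma_finiteP[B [TB ndB Boo]] := sigma_finiteT nu.
  exists (fun k => A k `*` B k).
    rewrite -setXTT TA TB predeqE => -[x y]; split.
      move=> [/= [k _ Akx] [l _ Bly]]; exists (maxn k l) => //; split.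
        by move: x Akx; exact/subsetPset/ndA/leq_maxl.
      by move: y Bly; exact/subsetPset/ndB/leq_maxr.
    by move=> [k _ []/= ? ?]; split; exists k.
  move=> k; have [? ?] := Aoo k; have [? ?] := Boo k.
  split; first exact: measurableX.
  by rewrite product_measure1E// lte_mul_pinfty// ge0_fin_numE.
pose uncons (t : n.+1.-tuple T) := (thead t, [tuple of behead t]) : T * n.-tuple T.
have unconsK p : uncons (cons_tup p) = p.
  by case: p => x t; rewrite /uncons /cons_tup theadE; congr pair; exact: val_inj.
have muncons : measurable_fun setT uncons.
  apply: measurable_fun_pair; first exact: (measurable_tnth ord0).
  exact: measurable_behead.
exists (fun i => uncons @^-1` F i).
  by rewrite -preimage_bigcup -FT preimage_setT.
move=> i; have [mFi Fi] := mF i; split.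
  by rewrite -[X in measurable X]setTI; exact: muncons.
rewrite /cons_measure /pushforward -comp_preimage (_ : uncons \o _ = id) ?preimage_id //.
by apply/funext => p /=; rewrite unconsK.
Qed.

HB.instance Definition _ :=
  @Measure_isSigmaFinite.Build _ _ _ cons_measure cons_measure_sigma_finite.

End step.

(* [power_measure mu n] is the n-fold product [mu \x ... \x mu] on tuples. *)
Fixpoint power_measure (mu : {sigma_finite_measure set T -> \bar R}) (n : nat) :
    {sigma_finite_measure set (n.-tuple T) -> \bar R} :=
  if n is m.+1 then cons_measure mu (power_measure mu m)
  else \d_([tuple] : 0.-tuple T).

End power_measure.

(** ** Borel sets and Lebesgue measure on R^d *)

Definition rV_display : measure_display -> measure_display.
Proof. exact. Qed.

Section measurable_rV.
Context {R : realType}.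
Variable d : nat.

Let coord (i : 'I_d) (x : 'rV[R]_d) : R := x ord0 i.

Let rV_set0 : g_sigma_preimage coord set0.
Proof. exact: sigma_algebra0. Qed.

Let rV_setC A : g_sigma_preimage coord A -> g_sigma_preimage coord (~` A).
Proof. exact: sigma_algebraC. Qed.

Let rV_bigcup (F : (set 'rV[R]_d)^nat) :
  (forall i, g_sigma_preimage coord (F i)) ->
  g_sigma_preimage coord (\bigcup_i (F i)).
Proof. exact: sigma_algebra_bigcup. Qed.

(* The product sigma-algebra, which on R^d is the Borel one. *)
HB.instance Definition _ := @isMeasurable.Build
  (rV_display default_measure_display)
  'rV[R]_d (g_sigma_preimage coord) rV_set0 rV_setC rV_bigcup.

End measurable_rV.

Section lebesgue_rV.
Context {R : realType}.
Variable d : nat.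

Definition rV_of_tuple (t : d.-tuple R) : 'rV[R]_d := \row_i tnth t i.

Lemma measurable_rV_of_tuple : measurable_fun [set: d.-tuple R] rV_of_tuple.
Proof.
move=> _ Y mY; rewrite setTI.
have : preimage_set_system [set: d.-tuple R] rV_of_tuple
    (g_sigma_preimage (fun i (x : 'rV[R]_d) => x ord0 i))
    (rV_of_tuple @^-1` Y).
  by exists Y => //; rewrite setTI.
rewrite -g_sigma_preimage_comp.
rewrite (_ : (fun i => _ \o _) = fun i (t : d.-tuple R) => tnth t i)//.
by apply/funext => i; apply/funext => t; rewrite /= mxE.
Qed.

Definition lebesgue_rV : set 'rV[R]_d -> \bar R :=
  pushforward (power_measure (@lebesgue_measure R) d) rV_of_tuple.

HB.instance Definition _ := Measure.copy lebesgue_rV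
  (@measure_function_pushforward__canonical__measure_function_Measure
    _ _ _ _ _ (power_measure (@lebesgue_measure R) d) _ measurable_rV_of_tuple).

End lebesgue_rV.

Section norm.
Context {R : realType} {d : nat}.

Definition is_norm (nrm : 'rV[R]_d -> R) : Prop :=
  [/\ forall x, nrm x = 0 -> x = 0,
      forall (a : R) x, nrm (a *: x) = `|a| * nrm x &
      forall x y, nrm (x + y) <= nrm x + nrm y].

(* The topological [ball] of ['rV[R]_d] is the one of the sup norm. *)
Definition nball (nrm : 'rV[R]_d -> R) (x : 'rV[R]_d) (r : R) : set 'rV[R]_d :=
  [set y | nrm (y - x) < r].

End norm.

(** ** Classification *)

(* [true] encodes the label [1] and [false] the label [-1]. *)
Definition label (R : realType) (y : bool) : R := if y then 1 else - 1.
Arguments label {R} y.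

(* A pair (f, eta) bundled with the law of (X, Y), which the pair determines:
   [regressionP] is the defining property of E[Y | X]. *)
Record model (R : realType) (d : nat) := Model {
  law : probability ('rV[R]_d * bool)%type R ;
  density : 'rV[R]_d -> R ;
  regression : 'rV[R]_d -> R ;
  measurable_density : measurable_fun [set: 'rV[R]_d] density ;
  density_ge0 : forall x, 0 <= density x ;
  densityP : forall A : set 'rV[R]_d, measurable A ->
    (law (fst @^-1` A) = \int[@lebesgue_rV R d]_(x in A) (density x)%:E)%E ;
  measurable_regression : measurable_fun [set: 'rV[R]_d] regression ;
  regressionP : forall A : set 'rV[R]_d, measurable A ->
    (\int[law]_(z in fst @^-1` A) (label z.2)%:E =
     \int[law]_(z in fst @^-1` A) (regression z.1)%:E)%E }.

Section assumptions.
Context {R : realType} {d : nat}.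
Implicit Types (m : model R d) (A : set 'rV[R]_d).

Definition prX m A : \bar R := law m (fst @^-1` A).

Definition regression_on m A : R :=
  (\int[law m]_(z in fst @^-1` A) label z.2) / fine (prX m A).

Definition density_support m : set 'rV[R]_d := closure [set x | density m x != 0].

(* For fixed exponents, the class of models satisfying these conditions grows
   with Ca, Cb and Cc and shrinks when Cd or D grows. *)
Record assumptions (nrm : 'rV[R]_d -> R) (alpha beta Ca Cb Cc Cd D : R) m :
    Prop := Assumptions {
  margin : forall t, 0 < t ->
    (prX m [set x | (0 < `|regression m x| <= t)%R] <= (Ca * t `^ alpha)%:E)%E ;
  tail : forall t, 0 < t ->
    (prX m [set x | (density m x <= t)%R] <= (Cb * t `^ beta)%:E)%E ;
  smooth : forall r x, 0 < r -> density_support m x ->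
    `|regression_on m (nball nrm x r) - regression m x| <= Cc * r ^+ 2 ;
  minimal_mass : forall x r, 0 < r < D ->
    ((Cd * density m x)%:E * lebesgue_rV (nball nrm x r)
      <= prX m (nball nrm x r))%E }.

End assumptions.

Section risk.
Context {R : realType} {d : nat}.
Implicit Types (m : model R d) (N : nat).

(* A classifier sees the samples and the query point only, neither the
   density nor the regression function. *)
Definition classifier N : Type :=
  N.-tuple ('rV[R]_d * bool)%type -> 'rV[R]_d -> bool.

Definition measurable_classifier N : set (classifier N) :=
  [set g | measurable_fun setT
    (fun w : N.-tuple ('rV[R]_d * bool)%type * 'rV[R]_d => g w.1 w.2)].

Definition risk m N (g : classifier N) : \bar R :=
  (power_measure (law m) N \x law m)%E [set w | g w.1 w.2.1 != w.2.2].

(* The sign function takes values in {-1, 1}, so a value at 0 has to be chosen;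
   the Bayes risk does not depend on it. *)
Definition bayes m (x : 'rV[R]_d) : bool := 0 <= regression m x.

Definition bayes_risk m : \bar R := law m [set z | bayes m z.1 != z.2].

Definition excess_risk m N (g : classifier N) : \bar R :=
  (risk m g - bayes_risk m)%E.

Definition minimax_excess_risk (S : set (model R d)) N : \bar R :=
  ereal_inf [set ereal_sup [set excess_risk m g | m in S] |
             g in @measurable_classifier N].

End risk.

(* Main.v *)
From HB Require Import structures.
Require Import Defs.
From mathcomp Require Import all_boot all_order all_algebra.
From mathcomp Require Import all_classical all_reals all_analysis.
From mathcomp Require Import measurable_realfun zify ring lra.

Set Implicit Arguments.
Unset Strict Implicit.
Unset Printing Implicit Defensive.
Import Order.TTheory GRing.Theory Num.Theory.
Import numFieldNormedType.Exports.

Local Open Scope classical_set_scope.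
Local Open Scope ring_scope.

(** The hard models live on a periodic grid of step [4 h]. Each cell may contain
    an island, a cube of side [h] and low density [t] on which the regression
    function is the constant [h ^ 2] or [- h ^ 2], and always contains a filler
    cube of density [u >= t] with regression function 0; a bulk cube carries the
    remaining mass. Distinct cubes are at distance at least [h], so an average
    over a ball of radius [r] is exact when [r] is small compared with [h] and is
    off by at most [2 h ^ 2 = O(r ^ 2)] otherwise; the fillers provide the minimal
    mass at scales larger than [h].

    Flipping the sign on one island, which has mass [t h ^ d], is undetectable
    from [N] samples when [N t h ^ d h ^ 4 <= 1 / 4], since the two laws have
    affinity at least [(1 - t h ^ (d + 4)) ^ N]. Averaging over all signs bounds
    the excess risk below by a constant times [h ^ 2] times the mass of the islands,
    which the margin and tail conditions allow to be of order
    [t ^ beta <= h ^ (2 alpha)]. With [q = 4 N], the rate [N ^ (- beta)] comes from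
    [h = 1], [t = 1 / q], and the other rate from [h = q ^ (- beta / E)],
    [t = h ^ (2 alpha / beta)] with [E = beta d + 2 (alpha + 2 beta)]. When
    [beta > 1], the hypothesis on [alpha] and [beta] says that there is room for at
    least one island. *)

(** * Measures with a density and powers of measures *)

Section density_measure.
Local Open Scope ereal_scope.
Context d (T : measurableType d) (R : realType).
Variables (mu : {measure set T -> \bar R}) (phi : T -> R).
Hypothesis mphi : measurable_fun [set: T] phi.
Hypothesis phi0 : forall x, (0 <= phi x)%R.

(** The proofs of measurability and nonnegativity are arguments so that the measure structure can be
    attached to the term itself. *)
Definition density_measure of (measurable_fun [set: T] phi)
    & (forall x, (0 <= phi x)%R) : set T -> \bar R :=
  fun A => \int[mu]_(x in A) (phi x)%:E.

Local Notation nu := (density_measure mphi phi0).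

Let density_measure0 : nu set0 = 0.
Proof. exact: integral_set0. Qed.

Let density_measure_ge0 A : 0 <= nu A.
Proof. by apply: integral_ge0 => x _; rewrite lee_fin. Qed.

Let density_measure_sigma_additive : semi_sigma_additive nu.
Proof.
move=> F mF tF mUF; apply: cvg_toP.
  apply: ereal_nondecreasing_is_cvgn => m n mn.
  by apply: lee_sum_nneg_natr => // k _ _; exact: density_measure_ge0.
rewrite /density_measure ge0_integral_bigcup//=.
- exact/measurable_EFinP/measurable_funTS.
- by move=> x _; rewrite lee_fin.
Qed.

HB.instance Definition _ := isMeasure.Build _ _ _ nu
  density_measure0 density_measure_ge0 density_measure_sigma_additive.

Import HBNNSimple.

Let integral_density_nnsfun (f : {nnsfun T >-> R}) :
  \int[nu]_x (f x)%:E = \int[mu]_x ((f x)%:E * (phi x)%:E).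
Proof.
rewrite integralT_nnsfun sintegralE.
rewrite (eq_integral (fun x => \sum_(r \in range f)
    ((phi x)%:E * (r * \1_(f @^-1` [set r]) x)%:E))); last first.
  move=> x _; rewrite [in LHS]fimfunE -fsumEFin// muleC ge0_mule_fsumr// => r.
  by rewrite EFinM nnfun_muleindic_ge0.
rewrite ge0_integral_fsum//; last 2 first.
- move=> r; apply: emeasurable_funM; apply/measurable_EFinP => //.
  by apply: measurable_funM => //; exact: measurable_indic.
- move=> r x _; apply: mule_ge0; first by rewrite lee_fin.
  by rewrite EFinM nnfun_muleindic_ge0.
apply: eq_fsbigr => r; rewrite inE => -[z _ fzr].
have r0 : (0 <= r)%R by rewrite -fzr.
transitivity (r%:E * \int[mu]_x ((\1_(f @^-1` [set r]) x)%:E * (phi x)%:E)).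
  congr (_ * _); rewrite /nu/= /density_measure integral_mkcond.
  apply: eq_integral => y _; rewrite patchE indicE.
  by case: (y \in _); rewrite ?mul1e ?mul0e.
rewrite -ge0_integralZl//; last 2 first.
- by apply: emeasurable_funM; apply/measurable_EFinP => //; exact: measurable_indic.
- by move=> y _; rewrite mule_ge0 ?lee_fin.
by apply: eq_integral => y _; rewrite EFinM muleA [RHS]muleC.
Qed.

(** Simple functions are handled by linearity; monotone convergence along [nnsfun_approx], on both
    sides, does the rest. *)
Lemma ge0_integral_densityT (f : T -> \bar R) : measurable_fun setT f ->
  (forall x, 0 <= f x) ->
  \int[nu]_x f x = \int[mu]_x (f x * (phi x)%:E).
Proof.
move=> mf f0; pose f_ := nnsfun_approx measurableT mf.
have cvgf x : (f_ n x)%:E @[n --> \oo] --> f x by exact: cvg_nnsfun_approx.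
transitivity (limn (fun n => \int[nu]_x (f_ n x)%:E)).
  rewrite -monotone_convergence//=.
  - by apply: eq_integral => x _; apply/esym/cvg_lim => //; exact: cvgf.
  - by move=> n; exact/measurable_EFinP/measurable_funTS.
  - by move=> n x _; rewrite lee_fin.
  - by move=> x _ a b ab; rewrite lee_fin; exact/lefP/nd_nnsfun_approx.
under eq_fun do rewrite integral_density_nnsfun.
rewrite -monotone_convergence//=.
- apply: eq_integral => x _; apply/cvg_lim => //.
  by under eq_fun do rewrite muleC; rewrite muleC; apply: cvgeZl => //; exact: cvgf.
- by move=> n; apply: emeasurable_funM; apply/measurable_EFinP.
- by move=> n x _; rewrite mule_ge0 ?lee_fin.
- move=> x _ a b ab; rewrite lee_wpmul2r ?lee_fin//.
  exact/lefP/nd_nnsfun_approx.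
Qed.

Lemma ge0_integral_density D (f : T -> \bar R) : measurable D ->
  measurable_fun setT f -> (forall x, 0 <= f x) ->
  \int[nu]_(x in D) f x = \int[mu]_(x in D) (f x * (phi x)%:E).
Proof.
move=> mD mf f0; rewrite [LHS]integral_mkcond.
rewrite [LHS](@ge0_integral_densityT (f \_ D)).
- rewrite [RHS]integral_mkcond; apply: eq_integral => x _; rewrite !patchE.
  by case: ifP => //; rewrite mul0e.
- by apply/(measurable_restrictT _ _).1 => //; exact: measurable_funTS.
- by move=> x; rewrite patchE; case: ifP.
Qed.

End density_measure.

Lemma measurable_forall d (T : measurableType d) (I : finType) (F : I -> set T) :
  (forall i, measurable (F i)) -> measurable [set x | forall i, F i x].
Proof.
move=> mF; rewrite (_ : [set x | _] = \bigcap_i F i).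
  by apply: fin_bigcap_measurable => //; exact: finite_finset.
by apply/seteqP; split => x /= Fx i => [_|]; exact: Fx.
Qed.

(** * Integration against finite powers of a measure *)

Section power_measure_lemmas.
Local Open Scope ereal_scope.
Context (R : realType) d (T : measurableType d).

Lemma ge0_integral_power_measureS (mu : {sigma_finite_measure set T -> \bar R})
    n (f : n.+1.-tuple T -> \bar R) :
  measurable_fun setT f -> (forall w, 0 <= f w) ->
  \int[power_measure mu n.+1]_w f w =
  \int[mu]_x \int[power_measure mu n]_w f (cons_tup (x, w)).
Proof.
move=> mf f0.
transitivity (\int[(mu \x power_measure mu n)]_z (f \o @cons_tup _ T n) z).
  rewrite -[RHS](@ge0_integral_pushforward _ _ _ _ _ (@cons_tup _ T n)
    (@measurable_cons_tup _ T n) _ setT)//.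
rewrite fubini_tonelli1//.
  exact: (measurableT_comp mf (@measurable_cons_tup _ T n)).
by move=> z; exact: f0.
Qed.

Lemma integral_power_measure0 (mu : {sigma_finite_measure set T -> \bar R})
    (f : 0.-tuple T -> \bar R) : measurable_fun setT f ->
  \int[power_measure mu 0]_w f w = f [tuple].
Proof. by move=> mf; rewrite integral_dirac// diracT mul1e. Qed.

Lemma measurable_prod_tnth n (a : T -> R) : measurable_fun setT a ->
  measurable_fun setT (fun w : n.-tuple T => \prod_(i < n) a (tnth w i))%R.
Proof.
move=> ma; apply: measurable_prod => i _ /=.
exact: measurableT_comp ma (measurable_tnth i).
Qed.

Lemma prod_cons_tup n (a : T -> R) x (w : n.-tuple T) :
  (\prod_(i < n.+1) a (tnth (cons_tup (x, w)) i) =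
   a x * \prod_(i < n) a (tnth w i))%R.
Proof.
by rewrite big_ord_recl; congr (_ * _)%R; apply: eq_bigr => i _; rewrite tnthS.
Qed.

(** Induction on the sample size: Tonelli peels off the first sample, whose density is [a], and the
    remaining product is pulled out as a constant. *)
Lemma ge0_integral_power_density (mu nu : {sigma_finite_measure set T -> \bar R})
    (a : T -> R) :
  measurable_fun setT a -> (forall x, 0 <= a x)%R ->
  (forall f, measurable_fun setT f -> (forall x, 0 <= f x) ->
    \int[nu]_x f x = \int[mu]_x (f x * (a x)%:E)) ->
  forall n (f : n.-tuple T -> \bar R), measurable_fun setT f ->
    (forall w, 0 <= f w) ->
  \int[power_measure nu n]_w f w =
  \int[power_measure mu n]_w (f w * (\prod_(i < n) a (tnth w i))%:E).
Proof.
move=> ma a0 numu; elim=> [|n IH] f mf f0.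
  rewrite !integral_power_measure0 ?big_ord0 ?mule1//.
  apply: emeasurable_funM => //; apply/measurable_EFinP.
  exact: measurable_prod_tnth.
have mP : measurable_fun setT (fun w : n.-tuple T => (\prod_(i < n) a (tnth w i))%:E).
  by apply/measurable_EFinP; exact: measurable_prod_tnth.
have mfc : measurable_fun setT (f \o @cons_tup _ T n).
  exact: (measurableT_comp mf (@measurable_cons_tup _ T n)).
have mfx x : measurable_fun setT (fun w => f (cons_tup (x, w))).
  by apply: (measurableT_comp mfc) => /=; exact: measurable_pair1.
rewrite !ge0_integral_power_measureS//; last 2 first.
- apply: emeasurable_funM => //; apply/measurable_EFinP.
  exact: measurable_prod_tnth.
- by move=> w; rewrite mule_ge0// lee_fin prodr_ge0.
rewrite numu; last 2 first.
- exact: (measurable_fun_fubini_tonelli_F _ mfc (fun=> f0 _)).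
- by move=> x; apply: integral_ge0.
apply: eq_integral => x _; rewrite IH// -ge0_integralZr//; last 3 first.
- by apply: emeasurable_funM.
- by move=> w _; rewrite mule_ge0// lee_fin prodr_ge0.
- by rewrite lee_fin.
apply: eq_integral => w _; rewrite prod_cons_tup EFinM -!muleA; congr (_ * _).
by rewrite muleC.
Qed.

(** Tensorization: applied to a function of affinity [k], it gives the affinity [k ^+ n] of the
    sample laws. *)
Lemma integral_power_prod (mu : {sigma_finite_measure set T -> \bar R})
    (a : T -> R) : measurable_fun setT a -> (forall x, 0 <= a x)%R ->
  forall n, \int[power_measure mu n]_w (\prod_(i < n) a (tnth w i))%:E =
  (\int[mu]_x (a x)%:E) ^+ n.
Proof.
move=> ma a0; elim=> [|n IH].
  rewrite integral_power_measure0 ?big_ord0//.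
  by apply/measurable_EFinP; exact: measurable_prod_tnth.
rewrite ge0_integral_power_measureS//; last 2 first.
- by apply/measurable_EFinP; exact: measurable_prod_tnth.
- by move=> w; rewrite lee_fin prodr_ge0.
rewrite expeS -ge0_integralZr//; last 3 first.
- exact/measurable_EFinP.
- by move=> x _; rewrite lee_fin.
- by rewrite expe_ge0// integral_ge0// => x _; rewrite lee_fin.
apply: eq_integral => x _; rewrite -IH -ge0_integralZl//.
- by apply: eq_integral => w _; rewrite prod_cons_tup.
- by apply/measurable_EFinP; exact: measurable_prod_tnth.
- by move=> w _; rewrite lee_fin prodr_ge0.
- by rewrite lee_fin.
Qed.

Lemma power_measure_setT (mu : {sigma_finite_measure set T -> \bar R}) n :
  mu setT = 1 -> power_measure mu n setT = 1.
Proof.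
move=> mu1; elim: n => [|n IH]; first exact: diracT.
rewrite /= /cons_measure /pushforward preimage_setT -setXTT.
transitivity (mu setT * power_measure mu n setT); last by rewrite mu1 IH mul1e.
exact: product_measure1E.
Qed.

Lemma power_measure_box (mu : {sigma_finite_measure set T -> \bar R}) n
    (A : 'I_n -> set T) : (forall i, measurable (A i)) ->
  power_measure mu n [set w | forall i, A i (tnth w i)] = \prod_(i < n) mu (A i).
Proof.
elim: n A => [|n IH] A mA.
  by rewrite big_ord0 /= diracE mem_set// => -[].
have mbox k (B : 'I_k -> set T) : (forall i, measurable (B i)) ->
    measurable [set w : k.-tuple T | forall i, B i (tnth w i)].
  move=> mB; apply: (@measurable_forall _ _ _ (fun i => (@tnth k T)^~ i @^-1` B i)).
  by move=> i; rewrite -[X in measurable X]setTI; exact: measurable_tnth.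
rewrite big_ord_recl -IH//.
transitivity ((mu \x power_measure mu n)
    (A ord0 `*` [set w | forall i, A (lift ord0 i) (tnth w i)])); last first.
  by apply: product_measure1E => //; exact: (mbox n (fun i => A (lift ord0 i))).
congr (product_measure1 _ _ _).
apply/seteqP; split => -[x w] /=.
  by move=> H; split; [exact: (H ord0)|move=> i; move: (H (lift ord0 i)); rewrite tnthS].
move=> [H0 H] i; have [<-|/unlift_some[j -> _]] := eqVneq ord0 i; first by [].
by rewrite tnthS.
Qed.

End power_measure_lemmas.

(** * Two-point bound and Assouad averaging *)

Section two_points.
Context (R : realType) d (T : measurableType d).
Variables (mu P Q : probability T R) (a b c : T -> R).
Hypotheses (ma : measurable_fun [set: T] a) (mb : measurable_fun [set: T] b)
  (mc : measurable_fun [set: T] c).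
(* [c] stands in for the geometric mean of the densities [a] and [b]. *)
Hypotheses (a0 : forall x, 0 <= a x) (b0 : forall x, 0 <= b x)
  (c0 : forall x, 0 <= c x) (cab : forall x, c x ^+ 2 <= a x * b x).
Hypotheses
  (Pa : forall f, measurable_fun setT f -> (forall x, 0 <= f x)%E ->
    (\int[P]_x f x = \int[mu]_x (f x * (a x)%:E))%E)
  (Qb : forall f, measurable_fun setT f -> (forall x, 0 <= f x)%E ->
    (\int[Q]_x f x = \int[mu]_x (f x * (b x)%:E))%E).

(* AM-GM: [min A B + (A + B) / 4 >= sqrt (A B)]. *)
Let amgm (A B C v f : R) : 0 <= A -> 0 <= B -> 0 <= C -> C ^+ 2 <= A * B ->
  0 <= f <= v -> v * C <= f * A + (v - f) * B + v / 4 * (A + B).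
Proof.
move=> A0 B0 C0 CAB /andP[f0 fv].
have {CAB} H : C <= Num.min A B + (A + B) / 4.
  rewrite -(@ler_pXn2r _ 2)// ?nnegrE//.
  (* When [A <= B] the right side is [(5 A + B) / 4], and 16 times the difference of its square and
     [A B] is [(3 A - B)^2 + (4 A)^2]. The other case is symmetric. *)
  - apply: (le_trans CAB); rewrite -subr_ge0; case: (leP A B) => AB.
      by have := sqr_ge0 (3 * A - B); have := sqr_ge0 A; nra.
    by have := sqr_ge0 (3 * B - A); have := sqr_ge0 B; nra.
  - by rewrite addr_ge0// ?mulr_ge0// ?addr_ge0// le_min A0.
have v0 : 0 <= v by exact: le_trans fv.
have : v * C <= v * (Num.min A B + (A + B) / 4) by rewrite ler_wpM2l.
by move/le_trans; apply; case: (leP A B) => AB; nra.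
Qed.

(** Le Cam's argument: a test cannot do well under both laws. With [A], [B], [C] the products of
    [a], [b], [c] over the sample, [amgm] is integrated pointwise; [A] and [B] integrate to 1, so
    the term [v / 4 * (A + B)] costs [v / 2], while [v * C] contributes [v * k ^+ n]. *)
Lemma two_point_bound (k : R) n (f : n.-tuple T -> R) v :
  (\int[mu]_x (c x)%:E = k%:E)%E ->
  measurable_fun setT f -> (forall w, 0 <= f w <= v) ->
  ((v * (k ^+ n - 2^-1))%:E <= \int[power_measure P n]_w (f w)%:E +
    \int[power_measure Q n]_w (v - f w)%:E)%E.
Proof.
move=> ck mf fv.
have f0 w : 0 <= f w by have /andP[] := fv w.
have vf0 w : 0 <= v - f w by rewrite subr_ge0; have /andP[] := fv w.
have v0 : 0 <= v by rewrite -[v](subrK (f (nseq_tuple n point))) addr_ge0.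
pose A (w : n.-tuple T) := \prod_(i < n) a (tnth w i).
pose B (w : n.-tuple T) := \prod_(i < n) b (tnth w i).
pose C (w : n.-tuple T) := \prod_(i < n) c (tnth w i).
have A0 w : 0 <= A w by exact: prodr_ge0.
have B0 w : 0 <= B w by exact: prodr_ge0.
have C0 w : 0 <= C w by exact: prodr_ge0.
have mA : measurable_fun setT A by exact: measurable_prod_tnth.
have mB : measurable_fun setT B by exact: measurable_prod_tnth.
have mC : measurable_fun setT C by exact: measurable_prod_tnth.
have CAB w : C w ^+ 2 <= A w * B w.
  rewrite -prodrXl -big_split/=; apply: ler_prod => i _.
  by rewrite exprn_ge0//=; exact: cab.
have mvf : measurable_fun setT (fun w => v - f w) by exact: measurable_funB.
have intA : (\int[power_measure mu n]_w (A w)%:E = 1)%E.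
  rewrite -[RHS](power_measure_setT n (probability_setT P)) -[RHS]mul1e.
  rewrite -integral_cst// (ge0_integral_power_density ma a0 Pa)//.
  by apply: eq_integral => w _; rewrite mul1e.
have intB : (\int[power_measure mu n]_w (B w)%:E = 1)%E.
  rewrite -[RHS](power_measure_setT n (probability_setT Q)) -[RHS]mul1e.
  rewrite -integral_cst// (ge0_integral_power_density mb b0 Qb)//.
  by apply: eq_integral => w _; rewrite mul1e.
have intC : (\int[power_measure mu n]_w (C w)%:E = (k ^+ n)%:E)%E.
  by rewrite (integral_power_prod _ mc c0) ck EFin_expe.
have EmA : measurable_fun setT (EFin \o A) by exact/measurable_EFinP.
have EmB : measurable_fun setT (EFin \o B) by exact/measurable_EFinP.
have EmC : measurable_fun setT (EFin \o C) by exact/measurable_EFinP.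
have Emf : measurable_fun setT (EFin \o f) by exact/measurable_EFinP.
have Emvf : measurable_fun setT (fun w => (v - f w)%:E) by exact/measurable_EFinP.
rewrite (ge0_integral_power_density ma a0 Pa)//.
rewrite (ge0_integral_power_density mb b0 Qb)//.
set I1 := integral _ _ _; set I2 := integral _ _ _.
have I3 : (\int[power_measure mu n]_w ((v / 4)%:E * ((A w)%:E + (B w)%:E)) =
    (v / 2)%:E)%E.
  rewrite ge0_integralZl//; last 3 first.
  - by apply: emeasurable_funD.
  - by move=> w _; rewrite -EFinD lee_fin addr_ge0.
  - by rewrite lee_fin divr_ge0.
  rewrite ge0_integralD//; last 2 first.
  - by move=> w _; rewrite lee_fin.
  - by move=> w _; rewrite lee_fin.
  by rewrite intA intB -EFinD -EFinM; congr EFin; field.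
suff: ((v * k ^+ n)%:E - (v / 2)%:E <= I1 + I2)%E by rewrite -EFinB -mulrBr.
rewrite leeBlDr// EFinM -intC -I3 -ge0_integralZl//; last first.
  by move=> w _; rewrite lee_fin.
have m1 : measurable_fun setT (fun w => (f w)%:E * (A w)%:E)%E.
  by apply: emeasurable_funM; exact/measurable_EFinP.
have m2 : measurable_fun setT (fun w => (v - f w)%:E * (B w)%:E)%E.
  by apply: emeasurable_funM; exact/measurable_EFinP.
have m3 : measurable_fun setT (fun w => (v / 4)%:E * ((A w)%:E + (B w)%:E))%E.
  by apply: emeasurable_funM => //; exact: emeasurable_funD.
have p1 w : (0 <= (f w)%:E * (A w)%:E)%E by rewrite mule_ge0 ?lee_fin.
have p2 w : (0 <= (v - f w)%:E * (B w)%:E)%E by rewrite mule_ge0 ?lee_fin.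
have p3 w : (0 <= (v / 4)%:E * ((A w)%:E + (B w)%:E))%E.
  by rewrite mule_ge0// -?EFinD lee_fin ?divr_ge0// addr_ge0.
rewrite /I1 /I2 -ge0_integralD// -ge0_integralD//; last 2 first.
- by move=> w _; rewrite adde_ge0.
- exact: emeasurable_funD.
apply: ge0_le_integral => //.
- by move=> w _; rewrite -EFinM lee_fin mulr_ge0.
- exact: emeasurable_funM.
- by apply: emeasurable_funD => //; exact: emeasurable_funD.
- move=> w _; rewrite -(EFinD (A w)) -!EFinM -!EFinD lee_fin.
  exact: (amgm (A0 w) (B0 w) (C0 w) (CAB w) (fv w)).
Qed.

End two_points.

(** * Averaging over sign vectors *)

Definition flip (K : finType) (k : K) (s : {ffun K -> bool}) : {ffun K -> bool} :=
  [ffun j => if j == k then ~~ s j else s j].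

Lemma flipK (K : finType) (k : K) : involutive (flip k).
Proof.
by move=> s; apply/ffunP => j; rewrite !ffunE; case: eqP => // _; rewrite negbK.
Qed.

(** Sum over all [v]. Since [flip k] is a bijection of the sign vectors, the sum of
    [G v k + G (flip k v) k] is twice that of [G v k], so the average of [G v k] is at least
    [delta / 2] for each [k]; exchanging the two sums compares this with [s]. *)
Lemma assouad (R : realFieldType) (K : finType)
    (G : {ffun K -> bool} -> K -> R) (delta s : R) :
  (forall v k, delta <= G v k + G (flip k v) k) ->
  (forall v, \sum_k G v k <= s) -> #|K|%:R * (delta / 2) <= s.
Proof.
move=> Gdelta Gs; pose n : R := #|{ffun K -> bool}|%:R.
have n0 : 0 < n by rewrite ltr0n; apply/card_gt0P; exists [ffun=> false].
have G2 k : n * (delta / 2) <= \sum_v G v k.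
  have : \sum_(v : {ffun K -> bool}) delta <= \sum_v (G v k + G (flip k v) k).
    by apply: ler_sum => v _; exact: Gdelta.
  have -> : \sum_v (G v k + G (flip k v) k) = \sum_v G v k + \sum_v G v k.
    by rewrite big_split; congr (_ + _); rewrite [RHS](reindex_inj (inv_inj (flipK k))).
  rewrite sumr_const -[delta *+ _]mulr_natl => H.
  by rewrite mulrA ler_pdivrMr// mulrDr mulr1; exact: H.
have Gn : \sum_(v : {ffun K -> bool}) \sum_k G v k <= n * s.
  by rewrite /n mulr_natl -sumr_const; apply: ler_sum => v _; exact: Gs.
rewrite -(ler_pM2l n0); apply: le_trans Gn; rewrite exchange_big/= mulrCA.
by rewrite mulr_natl -sumr_const; apply: ler_sum => k _; exact: G2.
Qed.

(** * Models built from a density and a regression function *)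

Section labelled.
Local Open Scope ereal_scope.
Context d (X : measurableType d) (R : realType) (L : {measure set X -> \bar R}).

Lemma measurable_pairl (b : bool) : measurable_fun [set: X] (fun x => (x, b)).
Proof. exact: measurable_fun_pair. Qed.

Definition with_label (b : bool) : set (X * bool) -> \bar R :=
  pushforward L (fun x => (x, b)).

HB.instance Definition _ b := Measure.copy (with_label b)
  (@measure_function_pushforward__canonical__measure_function_Measure
    _ _ _ _ _ L _ (measurable_pairl b)).

(** The product of [L] with counting measure on the labels, written as a sum of two pushforwards so
    that integrals split by label at once. *)
Definition labelled : set (X * bool) -> \bar R :=
  measure_add (with_label true) (with_label false).

HB.instance Definition _ := Measure.on labelled.

Lemma ge0_integral_labelled D (F : X * bool -> \bar R) :
  measurable D -> measurable_fun setT F -> (forall z, 0 <= F z) ->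
  \int[labelled]_(z in D) F z =
  \int[L]_(x in [set x | D (x, true)]) F (x, true) +
  \int[L]_(x in [set x | D (x, false)]) F (x, false).
Proof.
move=> mD mF F0; have mFD : measurable_fun D F by exact: measurable_funTS.
rewrite ge0_integral_measure_add//.
by congr (_ + _);
  exact: (@ge0_integral_pushforward _ _ _ _ _ _ (measurable_pairl _)).
Qed.

End labelled.

(** Turns the integral of a signed bounded function into that of a nonnegative one, to which the
    change of density applies. *)
Lemma integral_shift1 d (T : measurableType d) (R : realType)
    (P : probability T R) (D : set T) (h : T -> R) : measurable D ->
  measurable_fun setT h -> (forall x, `|h x| <= 1) ->
  (\int[P]_(x in D) (h x)%:E = \int[P]_(x in D) (1 + h x)%:E - P D)%E.
Proof.
move=> mD mh h1.
have PDoo : (P D < +oo)%E by rewrite (le_lt_trans (probability_le1 P mD))// ltry.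
have ih : P.-integrable D (EFin \o h).
  apply: measurable_bounded_integrable => //; first exact: measurable_funTS.
  by exists 1; split; [exact: num_real|move=> M M1 x _ /=; exact: le_trans (ltW M1)].
have i1 : P.-integrable D (EFin \o cst 1).
  apply: measurable_bounded_integrable => //.
  by exists 1; split; [exact: num_real|move=> M M1 x _ /=; rewrite normr1 ltW].
under [in RHS]eq_integral do rewrite EFinD.
rewrite integralD// integral_cst// mul1e addeAC subee ?add0e//.
by rewrite ge0_fin_numE.
Qed.

(** What has to be given for a law with prescribed density and regression function to exist:
    [pd_eta_le1] makes [(1 + eta) / 2] and [(1 - eta) / 2] conditional probabilities of the two
    labels. *)
Record pair_data (R : realType) (d : nat) := PairData {
  pd_f : 'rV[R]_d -> R ;
  pd_eta : 'rV[R]_d -> R ;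
  measurable_pd_f : measurable_fun [set: 'rV[R]_d] pd_f ;
  measurable_pd_eta : measurable_fun [set: 'rV[R]_d] pd_eta ;
  pd_f_ge0 : forall x, 0 <= pd_f x ;
  pd_eta_le1 : forall x, `|pd_eta x| <= 1 ;
  pd_f_int : (\int[@lebesgue_rV R d]_x (pd_f x)%:E = 1)%E }.

Lemma measurable_label (R : realType) : measurable_fun [set: bool] (@label R).
Proof. by []. Qed.

Lemma label_le1 (R : realType) b : `|@label R b| <= 1.
Proof. by case: b; rewrite /label ?normrN normr1. Qed.

Section pair_model.
Context (R : realType) (d : nat) (D : pair_data R d).
Local Notation f := (pd_f D).
Local Notation eta := (pd_eta D).
Local Notation X := ('rV[R]_d).

(** The conditional probability of the label [z.2] at the point [z.1]. *)
Definition label_weight (z : X * bool) : R := (1 + eta z.1 * label z.2) / 2.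
Definition label_density (z : X * bool) : R := f z.1 * label_weight z.

Lemma measurable_label_weight : measurable_fun setT label_weight.
Proof.
apply: measurable_funM => //; apply: measurable_funD => //.
apply: measurable_funM.
  exact: measurableT_comp (measurable_pd_eta D) measurable_fst.
exact: measurableT_comp (@measurable_label R) measurable_snd.
Qed.

Lemma label_weight_ge0 z : 0 <= label_weight z.
Proof.
rewrite /label_weight; have := pd_eta_le1 D z.1; rewrite ler_norml => /andP[].
by case: z.2; rewrite /label; lra.
Qed.

Lemma measurable_label_density : measurable_fun setT label_density.
Proof.
apply: measurable_funM measurable_label_weight.
exact: measurableT_comp (measurable_pd_f D) measurable_fst.
Qed.

Lemma label_density_ge0 z : 0 <= label_density z.
Proof. by rewrite mulr_ge0// ?pd_f_ge0// label_weight_ge0. Qed.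

Definition pair_law : set (X * bool) -> \bar R :=
  density_measure (labelled (@lebesgue_rV R d))
    measurable_label_density label_density_ge0.

HB.instance Definition _ := Measure.on pair_law.

Lemma pair_law_integral (A : set X) (F : X * bool -> R) : measurable A ->
  measurable_fun setT F -> (forall z, 0 <= F z) ->
  (\int[pair_law]_(z in fst @^-1` A) (F z)%:E = \int[@lebesgue_rV R d]_(x in A)
    (f x * (F (x, true) * ((1 + eta x) / 2) +
            F (x, false) * ((1 - eta x) / 2)))%:E)%E.
Proof.
move=> mA mF F0.
have mA' : measurable (fst @^-1` A : set (X * bool)).
  by rewrite -[X in measurable X]setTI; exact: measurable_fst.
have mpair b : measurable_fun setT (fun x => (F (x, b) * label_density (x, b))%:E).
  apply/measurable_EFinP; apply: measurable_funM.
    exact: measurableT_comp mF (measurable_pairl b).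
  exact: measurableT_comp measurable_label_density (measurable_pairl b).
have p0 z : (0 <= (F z * label_density z)%:E)%E.
  by rewrite lee_fin mulr_ge0// label_density_ge0.
rewrite /pair_law ge0_integral_density//; last exact/measurable_EFinP.
under eq_integral do rewrite -EFinM.
rewrite ge0_integral_labelled//; last first.
  apply/measurable_EFinP; apply: measurable_funM => //.
  exact: measurable_label_density.
rewrite -ge0_integralD//; try by apply: measurable_funTS.
apply: eq_integral => x _; rewrite -EFinD /label_density /label_weight /label/=.
by congr EFin; ring.
Qed.

Let pair_law_setT : pair_law setT = 1%E.
Proof.
rewrite -[LHS]mul1e -integral_cst//.
have -> : [set: X * bool] = fst @^-1` [set: X] by [].
rewrite (@pair_law_integral _ (cst 1))// -[RHS](pd_f_int D).
by apply: eq_integral => x _; congr EFin; rewrite /=; field.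
Qed.

HB.instance Definition _ :=
  @Measure_isProbability.Build _ _ _ pair_law pair_law_setT.

Lemma pair_law_fst (A : set X) : measurable A ->
  (pair_law (fst @^-1` A) = \int[@lebesgue_rV R d]_(x in A) (f x)%:E)%E.
Proof.
move=> mA; rewrite -[LHS]mul1e -integral_cst//; last first.
  by rewrite -[X in measurable X]setTI; exact: measurable_fst.
rewrite (@pair_law_integral _ (cst 1))//.
by apply: eq_integral => x _; congr EFin; rewrite /=; field.
Qed.

(** After shifting both integrands by 1, the label can be averaged out at each point, and its
    conditional mean at [x] is [eta x]. *)
Lemma pair_law_regression (A : set X) : measurable A ->
  (\int[pair_law]_(z in fst @^-1` A) (label z.2)%:E =
   \int[pair_law]_(z in fst @^-1` A) (eta z.1)%:E)%E.
Proof.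
move=> mA.
have mA' : measurable (fst @^-1` A : set (X * bool)).
  by rewrite -[X in measurable X]setTI; exact: measurable_fst.
have ml : measurable_fun [set: X * bool] (fun z => @label R z.2).
  exact: measurableT_comp (@measurable_label R) measurable_snd.
have me : measurable_fun [set: X * bool] (fun z => eta z.1).
  exact: measurableT_comp (measurable_pd_eta D) measurable_fst.
rewrite (@integral_shift1 _ _ _ _ _ (fun z => label z.2))//; last first.
  by move=> z; exact: label_le1.
rewrite (@integral_shift1 _ _ _ _ _ (fun z => eta z.1))//; last first.
  by move=> z; exact: pd_eta_le1.
congr (_ - _)%E.
rewrite (@pair_law_integral _ (fun z => 1 + label z.2))//; last 2 first.
- exact: measurable_funD.
- by move=> z; have := label_le1 R z.2; rewrite ler_norml => /andP[]; lra.
rewrite (@pair_law_integral _ (fun z => 1 + eta z.1))//; last 2 first.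
- exact: measurable_funD.
- by move=> z; have := pd_eta_le1 D z.1; rewrite ler_norml => /andP[]; lra.
by apply: eq_integral => x _; congr EFin; rewrite /label/=; field.
Qed.

Definition pair_model : model R d :=
  @Model R d pair_law f eta (measurable_pd_f D) (pd_f_ge0 D) pair_law_fst
    (measurable_pd_eta D) pair_law_regression.

End pair_model.

(** * Minimax lower bound for sign perturbations on disjoint cells *)

Lemma bernoulli_ineq (R : realFieldType) (x : R) n :
  0 <= x <= 1 -> 1 - n%:R * x <= (1 - x) ^+ n.
Proof.
move=> /andP[x0 x1]; elim: n => [|n IH]; first by rewrite expr0; lra.
rewrite exprS; apply: (@le_trans _ _ ((1 - x) * (1 - n%:R * x))).
  rewrite -subr_ge0 (_ : _ - _ = n%:R * x ^+ 2) ?mulr_ge0 ?sqr_ge0//.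
  by rewrite -[n.+1]addn1 natrD; ring.
by rewrite ler_wpM2l// subr_ge0.
Qed.

Section minimax.
Context (R : realType) (d : nat).
Local Notation X := ('rV[R]_d).
Local Notation L := (@lebesgue_rV R d).
Variables (f : X -> R) (K : finType) (Q : K -> set X) (e : R).
Hypothesis mf : measurable_fun [set: X] f.
Hypothesis f0 : forall x, 0 <= f x.
Hypothesis f1 : (\int[L]_x (f x)%:E = 1)%E.
Hypothesis mQ : forall k, measurable (Q k).
Hypothesis tQ : forall j k x, Q j x -> Q k x -> j = k.
Hypothesis e01 : 0 <= e <= 1.

Definition cell_eta (v : {ffun K -> bool}) (x : X) : R :=
  \sum_k e * label (v k) * \1_(Q k) x.

Lemma sum_indic_in (a : K -> R) k x : Q k x -> \sum_j a j * \1_(Q j) x = a k.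
Proof.
move=> Qk; rewrite (bigD1 k)//= indicE mem_set// mulr1 big1 ?addr0// => j jk.
rewrite indicE memNset ?mulr0// => Qj.
by move: jk; rewrite (tQ Qj Qk) eqxx.
Qed.

Lemma sum_indic_out (a : K -> R) x : (forall k, ~ Q k x) ->
  \sum_j a j * \1_(Q j) x = 0.
Proof. by move=> Qk; rewrite big1// => j _; rewrite indicE memNset ?mulr0. Qed.

Lemma cell_eta_in v k x : Q k x -> cell_eta v x = e * label (v k).
Proof. exact: sum_indic_in. Qed.

Lemma cell_eta_out v x : (forall k, ~ Q k x) -> cell_eta v x = 0.
Proof. exact: sum_indic_out. Qed.

Lemma cell_cases x : (exists k, Q k x) \/ (forall k, ~ Q k x).
Proof. by have [?|/forallNP ?] := pselect (exists k, Q k x); [left|right]. Qed.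

Lemma measurable_sum_indic (a : K -> R) :
  measurable_fun setT (fun x => \sum_j a j * \1_(Q j) x).
Proof.
by apply: measurable_sum => j; apply: measurable_funM.
Qed.

Lemma cell_eta_le1 v x : `|cell_eta v x| <= 1.
Proof.
have [[k Qk]|Qk] := cell_cases x; last by rewrite cell_eta_out ?normr0.
have /andP[? ?] := e01.
rewrite (cell_eta_in _ Qk) normrM mulr_ile1//; last exact: label_le1.
by rewrite ger0_norm.
Qed.

Definition cell_data v : pair_data R d :=
  PairData mf (measurable_sum_indic _ : measurable_fun setT (cell_eta v))
    f0 (cell_eta_le1 v) f1.

Lemma eta0_le1 (x : X) : `|cst (0 : R) x| <= 1.
Proof. by rewrite normr0. Qed.

(** The same density with pure noise labels. Its law dominates those of all cell models, and serves
    as the reference measure of the two-point bound; it also has their common marginal. *)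
Definition null_data : pair_data R d :=
  PairData mf (measurable_cst (0 : R)) f0 eta0_le1 f1.

Definition cell_model v := pair_model (cell_data v).

Local Notation law0 := (pair_law null_data).

(** The joint densities are [f (1 + eta y) / 2] and [f / 2], so the likelihood ratio is [1 + eta y].
    This is the form in which [two_point_bound] takes its two laws. *)
Lemma integral_cell_law v (F : X * bool -> \bar R) :
  measurable_fun setT F -> (forall z, 0 <= F z)%E ->
  (\int[pair_law (cell_data v)]_z F z =
   \int[law0]_z (F z * (1 + cell_eta v z.1 * label z.2)%:E))%E.
Proof.
move=> mF F0.
have mw : measurable_fun setT (fun z : X * bool => 1 + cell_eta v z.1 * label z.2).
  have := measurable_label_weight (cell_data v).
  move=> /(@measurable_funM _ _ _ _ (cst 2) _ (measurable_cst _)).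
  apply: eq_measurable_fun => z _.
  by rewrite /label_weight/=; field.
have w0 z : 0 <= 1 + cell_eta v z.1 * label z.2.
  have := label_weight_ge0 (cell_data v) z.
  by rewrite /label_weight/= pmulr_lge0// invr_gt0.
rewrite /pair_law ge0_integral_densityT// [RHS]ge0_integral_densityT//; last 2 first.
- by apply: emeasurable_funM => //; exact/measurable_EFinP.
- by move=> z; rewrite mule_ge0// lee_fin.
apply: eq_integral => z _; rewrite -muleA -EFinM; congr (_ * _)%E; congr EFin.
by rewrite /label_density /label_weight/=; field.
Qed.

Lemma measurable_disagreement (c : X -> bool) : measurable_fun setT c ->
  measurable [set z : X * bool | c z.1 != z.2].
Proof.
move=> mc.
pose E b : set (X * bool) := (c \o fst) @^-1` [set b] `&` snd @^-1` [set ~~ b].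
have mE b : measurable (E b).
  apply: measurableI; rewrite -[X in measurable X]setTI.
    exact: (measurableT_comp mc measurable_fst).
  exact: measurable_snd.
rewrite [X in measurable X](_ : _ = E true `|` E false); first exact: measurableU.
rewrite /E; apply/seteqP; split => -[x b] /=.
  by case: (c x); case: b => //= _; [left|right].
by case=> -[-> ->].
Qed.

Lemma pair_law_disagree (D : pair_data R d) (c : X -> bool) :
  measurable_fun setT c ->
  (pair_law D [set z | c z.1 != z.2] = \int[L]_x
    (pd_f D x * ((1 - pd_eta D x * label (c x)) / 2))%:E)%E.
Proof.
move=> mc; have mS := measurable_disagreement mc.
rewrite -[LHS]mul1e -integral_cst// integral_mkcond.
have -> : [set: X * bool] = fst @^-1` [set: X] by [].
rewrite (eq_integral (fun z => (\1_[set z : X * bool | c z.1 != z.2] z)%:E)); last first.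
  by move=> z _; rewrite patchE indicE; case: (_ \in _).
rewrite pair_law_integral//.
apply: eq_integral => x _; congr EFin; congr (_ * _).
have inE b : ((x, b) \in [set z : X * bool | c z.1 != z.2]) = (c x != b).
  by apply/idP/idP => [/set_mem|H]; last exact/mem_set.
rewrite !indicE !inE.
by case: (c x); rewrite /label/=; field.
Qed.

(** The excess risk as the mass of disagreement with the Bayes rule weighted by [|eta|]. Outside the
    cells [eta] is 0 and both labels are equally likely, so only the cells contribute. Stated as a
    sum, it involves no subtraction of extended reals. *)
Lemma cell_excess v (c : X -> bool) : measurable_fun setT c ->
  (bayes_risk (cell_model v) +
     \sum_k e%:E * law0 [set z | Q k z.1 /\ c z.1 != v k] =
   law (cell_model v) [set z | c z.1 != z.2])%E.
Proof.
move=> mc; rewrite /bayes_risk /=.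
have mb : measurable_fun setT (bayes (cell_model v)).
  apply: measurable_fun_ler => //; exact: measurable_sum_indic.
rewrite !pair_law_disagree//=.
have mS k : measurable [set x | Q k x /\ c x != v k].
  apply: measurableI => //.
  rewrite [X in measurable X](_ : _ = c @^-1` [set ~~ v k]).
    by rewrite -[X in measurable X]setTI; exact: mc.
  by apply/seteqP; split => x /=; case: (c x); case: (v k).
have /andP[e0 e1] := e01.
have mg k : measurable_fun setT
    ((fun x => e%:E * (f x)%:E)%E \_ [set x | Q k x /\ c x != v k]).
  apply/(measurable_restrictT _ _).1 => //; apply: measurable_funTS.
  by apply: emeasurable_funM => //; exact/measurable_EFinP.
have g0 k x : (0 <= ((fun x => e%:E * (f x)%:E) \_ [set x | Q k x /\ c x != v k]) x)%E.
  by rewrite patchE; case: ifP => // _; rewrite mule_ge0 ?lee_fin.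
have E k : (e%:E * law0 [set z | Q k z.1 /\ c z.1 != v k] = \int[L]_x
    ((fun x => e%:E * (f x)%:E) \_ [set x | Q k x /\ c x != v k]) x)%E.
  rewrite (pair_law_fst null_data (mS k)) -integral_mkcond ge0_integralZl//=.
  - by apply/measurable_EFinP; exact: measurable_funTS.
  - by move=> x _; rewrite lee_fin.
under eq_bigr do rewrite E.
have mw v' (c' : X -> bool) : measurable_fun setT c' ->
    measurable_fun setT (fun x => (f x * ((1 - cell_eta v' x * label (c' x)) / 2))%:E).
  move=> mc'; apply/measurable_EFinP; apply: measurable_funM => //.
  apply: measurable_funM => //; apply: measurable_funB => //.
  apply: measurable_funM; first exact: measurable_sum_indic.
  exact: measurableT_comp (@measurable_label R) mc'.
have w0 v' (c' : X -> bool) x : 0 <= f x * ((1 - cell_eta v' x * label (c' x)) / 2).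
  rewrite mulr_ge0// divr_ge0// subr_ge0 (le_trans (ler_norm _))//.
  by rewrite normrM mulr_ile1// ?cell_eta_le1// label_le1.
rewrite -ge0_integral_sum// -ge0_integralD//; last 4 first.
- by move=> x _; rewrite lee_fin.
- exact: mw.
- by move=> x _; apply: sume_ge0.
- exact: emeasurable_sum.
apply: eq_integral => x _.
have [[k Qk]|Qk] := cell_cases x; last first.
  rewrite (cell_eta_out _ Qk) big1 ?adde0; first by congr EFin; rewrite !mul0r.
  by move=> k _; rewrite patchE memNset// => -[/Qk].
rewrite (bigD1 k)//= big1 ?adde0; last first.
  move=> j jk; rewrite patchE memNset// => -[Qj _].
  by move: jk; rewrite (tQ Qj Qk) eqxx.
rewrite patchE /bayes /= (cell_eta_in _ Qk).
have -> : (x \in [set x | Q k x /\ c x != v k]) = (c x != v k).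
  by apply/idP/idP => [/set_mem[]|H]; last exact/mem_set.
(* When [e = 0] the Bayes rule is constantly [true] and may differ from [v k]; the identity still
   holds because all weights vanish. *)
have [->|e_neq0] := eqVneq e 0.
  by rewrite !mul0r !mul0e; case: ifP; rewrite adde0.
have e_gt0 : 0 < e by rewrite lt_neqAle eq_sym e_neq0.
rewrite pmulr_rge0//.
case: (v k); case: (c x); rewrite /label/= ?oppr_ge0 ?ler01 ?ler10 ?adde0 //;
  by rewrite -EFinM -EFinD; congr EFin; field.
Qed.


(** * Excess risk of a fixed classifier, averaged over the signs *)

Section classifier_bound.
Variables (N : nat) (p : R) (g : classifier N (R := R) (d := d)).
Hypothesis pE : forall k, (\int[L]_(x in Q k) (f x)%:E = p%:E)%E.
Hypothesis Np : N%:R * (e ^+ 2 * p) <= 4^-1.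
Hypothesis mg : measurable_classifier g.

(** The set constrains only the point, and all cell models have the same marginal, so [law0] can
    measure it for every [v]. Hence one function of the sample serves for both laws of a two-point
    comparison. *)
Let miss k b (w : N.-tuple (X * bool)) : \bar R :=
  law0 [set z | Q k z.1 /\ g w z.1 != b].

Lemma measurable_classifier_at w : measurable_fun setT (g w).
Proof. exact: (measurableT_comp mg (measurable_pair1 w)). Qed.

Let measurable_disagree k b w : measurable [set x | Q k x /\ g w x != b].
Proof.
apply: measurableI => //.
rewrite [X in measurable X](_ : _ = g w @^-1` [set ~~ b]).
  by rewrite -[X in measurable X]setTI; exact: measurable_classifier_at.
by apply/seteqP; split => x /=; case: (g w x); case: b.
Qed.

Let measurable_miss k b : measurable_fun setT (miss k b).
Proof.
pose A : set (N.-tuple (X * bool) * (X * bool)) :=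
  [set w | Q k w.2.1 /\ g w.1 w.2.1 != b].
have mA : measurable A.
  apply: measurableI.
    rewrite -[X in measurable X]setTI.
    by apply: (measurableT_comp measurable_fst measurable_snd) => //; exact: mQ.
  rewrite [X in measurable X](_ : _ =
      (fun w : N.-tuple (X * bool) * (X * bool) => g w.1 w.2.1) @^-1` [set ~~ b]).
    rewrite -[X in measurable X]setTI.
    have m2 : measurable_fun setT
        (fun w : N.-tuple (X * bool) * (X * bool) => (w.1, w.2.1)).
      apply: measurable_fun_pair => //.
      exact: (measurableT_comp measurable_fst measurable_snd).
    exact: (measurableT_comp mg m2).
  by apply/seteqP; split => x /=; case: (g _ _); case: (b).
rewrite (_ : miss k b = law0 \o xsection A); first exact: measurable_fun_xsection.
apply/funext => w; rewrite /miss /=; congr (law0 _).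
by apply/seteqP; split => z /=; rewrite /xsection/= ?in_setE.
Qed.

(** Missing one sign means predicting the opposite one: the errors under [v] and [flip k v] are [F]
    and [p - F], the shape that [two_point_bound] expects. *)
Let missD k b w : (miss k b w + miss k (~~ b) w = p%:E)%E.
Proof.
rewrite /miss -(pE k) -(pair_law_fst null_data (mQ k)) -measureU.
- congr (law0 _); apply/seteqP; split => z /=; first by case=> -[].
  by move=> Qz; case: (g w z.1); case: b; [right|left|left|right].
- rewrite (_ : [set z | _] = fst @^-1` [set x | Q k x /\ g w x != b])//.
  by rewrite -[X in measurable X]setTI; exact: measurable_fst.
- rewrite (_ : [set z | _] = fst @^-1` [set x | Q k x /\ g w x != ~~ b])//.
  by rewrite -[X in measurable X]setTI; exact: measurable_fst.
- by apply/seteqP; split => z //= -[[_]] + [_]; case: (g w z.1); case: b.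
Qed.

Let miss_ge0 k b w : (0 <= miss k b w)%E.
Proof. exact: measure_ge0. Qed.

Let miss_fin k b w : miss k b w \is a fin_num.
Proof.
rewrite ge0_fin_numE// (@le_lt_trans _ _ p%:E) ?ltry//.
by rewrite -(missD k b w) leeDl.
Qed.

Local Notation P v := (power_measure (pair_law (cell_data v)) N).

Let integral_power_cst v (r : \bar R) : (\int[P v]_w r = r)%E.
Proof.
rewrite integral_cst//.
by rewrite [X in (_ * X)%E](power_measure_setT N (probability_setT _)) mule1.
Qed.

Let miss_int v k : \bar R := (\int[P v]_w miss k (v k) w)%E.

Let bayes_risk_fin v : bayes_risk (cell_model v) \is a fin_num.
Proof.
apply: fin_num_measure; apply: measurable_disagreement.
by apply: measurable_fun_ler => //; exact: measurable_sum_indic.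
Qed.

(** Integrating [cell_excess] over the sample; the Bayes risk cancels because it is finite. *)
Let excessE v : (excess_risk (cell_model v) g = \sum_k e%:E * miss_int v k)%E.
Proof.
have /andP[e0 e1] := e01.
rewrite /excess_risk.
suff -> : (risk (cell_model v) g =
    bayes_risk (cell_model v) + \sum_k e%:E * miss_int v k)%E.
  by rewrite addeAC (subee (bayes_risk_fin v)) [LHS]add0e.
have b0 : (0 <= bayes_risk (cell_model v))%E by exact: measure_ge0.
transitivity (\int[P v]_w
    (bayes_risk (cell_model v) + \sum_k e%:E * miss k (v k) w))%E.
  apply: eq_integral => w _.
  rewrite (cell_excess v (measurable_classifier_at w)) /=; congr (pair_law _ _).
  by apply/seteqP; split => z /=; rewrite /xsection/= ?in_setE.
rewrite ge0_integralD//; last 2 first.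
- by move=> w _; apply: sume_ge0 => k _; rewrite mule_ge0.
- by apply: emeasurable_sum => k; apply: emeasurable_funM.
rewrite integral_power_cst.
congr (_ + _)%E; rewrite ge0_integral_sum//; last 2 first.
- by move=> k; apply: emeasurable_funM.
- by move=> k w _; rewrite mule_ge0.
by apply: eq_bigr => k _; rewrite ge0_integralZl.
Qed.

Let p_ge0 (k : K) : 0 <= p.
Proof.
rewrite -lee_fin -(missD k true (nseq_tuple N point)).
by rewrite adde_ge0.
Qed.

Let p_le1 (k : K) : p <= 1.
Proof.
rewrite -lee_fin -(pE k) -(pair_law_fst null_data (mQ k)).
apply: probability_le1.
by rewrite -[X in measurable X]setTI; exact: measurable_fst.
Qed.

(** The laws for [v] and [flip k v] differ only on cell [k] and have affinity at least
    [1 - e ^+ 2 * p]. By Bernoulli and [Np], its [N]-th power is at least 3/4, and subtracting the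
    1/2 of [two_point_bound] leaves [p / 4]. *)
Let miss_pair v k : ((p / 4)%:E <= miss_int v k + miss_int (flip k v) k)%E.
Proof.
have /andP[e0 e1] := e01.
have p0 := p_ge0 k; have p1 := p_le1 k.
pose a v' (z : X * bool) := 1 + cell_eta v' z.1 * label z.2.
(* On the cell the two densities are [1 + e] and [1 - e] in some order, with product [1 - e ^+ 2].
   Taking [c = 1 - e ^+ 2] there, below the geometric mean, avoids a square root; elsewhere [c] is
   the common density. *)
pose c (z : X * bool) := a v z - (a v z - (1 - e ^+ 2)) * \1_(Q k) z.1.
have ma v' : measurable_fun setT (a v').
  have := measurable_label_weight (cell_data v').
  move=> /(@measurable_funM _ _ _ _ (cst 2) _ (measurable_cst _)).
  by apply: eq_measurable_fun => z _; rewrite /a /label_weight/=; field.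
have a0 v' z : 0 <= a v' z.
  have := label_weight_ge0 (cell_data v') z.
  by rewrite /label_weight/= pmulr_lge0// invr_gt0.
have mc : measurable_fun setT c.
  apply: measurable_funB => //; apply: measurable_funM; first exact: measurable_funB.
  by apply: measurableT_comp measurable_fst; exact: measurable_indic.
have cin z : Q k z.1 -> c z = 1 - e ^+ 2.
  by move=> Qz; rewrite /c indicE mem_set// mulr1; ring.
have cout z : ~ Q k z.1 -> c z = a v z.
  by move=> Qz; rewrite /c indicE memNset// mulr0 subr0.
have e21 : e ^+ 2 <= 1 by rewrite expr_le1.
have c0 z : 0 <= c z.
  have [Qz|Qz] := pselect (Q k z.1); last by rewrite cout.
  by rewrite cin// subr_ge0.
have flip_out z : ~ Q k z.1 -> a (flip k v) z = a v z.
  move=> Qz; rewrite /a; congr (1 + _ * _); apply: eq_bigr => j _.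
  rewrite ffunE; have [->|//] := eqVneq j k.
  by rewrite indicE memNset// !mulr0.
have cab z : c z ^+ 2 <= a v z * a (flip k v) z.
  have [Qz|Qz] := pselect (Q k z.1); last by rewrite cout// flip_out// expr2.
  rewrite cin// /a !(cell_eta_in _ Qz) ffunE eqxx.
  have : 0 <= e ^+ 2 * (1 - e ^+ 2) by rewrite mulr_ge0 ?sqr_ge0// subr_ge0.
  by case: (v k); case: z.2; rewrite /label/=; nra.
have ic : (\int[law0]_z (c z)%:E = (1 - e ^+ 2 * p)%:E)%E.
  have -> : [set: X * bool] = fst @^-1` [set: X] by [].
  rewrite (pair_law_integral null_data)//=.
  transitivity (\int[L]_x (f x * (1 - e ^+ 2 * \1_(Q k) x))%:E)%E.
    apply: eq_integral => x _; congr EFin; congr (_ * _).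
    have [Qx|Qx] := pselect (Q k x).
      by rewrite !cin// indicE mem_set//=; field.
    by rewrite !cout// /a indicE memNset// /label/=; field.
  have mfq : measurable_fun setT (fun x => f x * (1 - e ^+ 2 * \1_(Q k) x)).
    apply: measurable_funM => //; apply: measurable_funB => //.
    by apply: measurable_funM => //; exact: measurable_indic.
  rewrite EFinB; apply/eqP; rewrite eq_sym sube_eq//;
    last exact: fin_num_adde_defl.
  apply/eqP.
  rewrite -f1 EFinM -(pE k) -ge0_integralZl//=; last 3 first.
  - by apply/measurable_EFinP; exact: measurable_funTS.
  - by move=> x _; rewrite lee_fin.
  - by rewrite lee_fin sqr_ge0.
  rewrite [X in (_ + X)%E]integral_mkcond -ge0_integralD//.
  - apply: eq_integral => x _; apply/esym; rewrite patchE indicE; case: (x \in Q k).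
      by rewrite mulr1 -EFinM -EFinD; congr EFin; ring.
    by rewrite adde0 mulr0 subr0 mulr1.
  - move=> x _; rewrite lee_fin mulr_ge0// subr_ge0 indicE.
    by case: (x \in Q k); rewrite ?mulr1 ?mulr0.
  - exact/measurable_EFinP.
  - move=> x _; rewrite patchE; case: ifP => // _.
    by rewrite mule_ge0 ?lee_fin ?sqr_ge0.
  - apply/(measurable_restrictT _ _).1 => //; apply: measurable_funTS.
    by apply: emeasurable_funM => //; exact/measurable_EFinP.
pose F w := fine (miss k (v k) w).
have mF : measurable_fun setT F.
  by apply: (measurableT_comp (@fine_measurable _ _ _)) => //; exact: measurable_miss.
have Fv w : 0 <= F w <= p.
  rewrite fine_ge0//= -lee_fin /F fineK// -(missD k (v k) w).
  by rewrite leeDl.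
have := @two_point_bound _ _ _ law0 (pair_law (cell_data v))
  (pair_law (cell_data (flip k v))) (a v) (a (flip k v)) c (ma _) (ma _) mc
  (a0 _) (a0 _) c0 cab (@integral_cell_law v) (@integral_cell_law (flip k v))
  _ N F p ic mF Fv.
have E1 : (\int[P v]_w (F w)%:E = miss_int v k)%E.
  by apply: eq_integral => w _; rewrite /F fineK.
have E2 : (\int[P (flip k v)]_w (p - F w)%:E = miss_int (flip k v) k)%E.
  apply: eq_integral => w _; rewrite /F EFinB fineK// -(missD k (v k) w).
  by rewrite addeAC subee// add0e ffunE eqxx.
rewrite E1 E2; apply: le_trans; rewrite lee_fin ler_wpM2l//.
have := @bernoulli_ineq R (e ^+ 2 * p) N; rewrite mulr_ge0 ?sqr_ge0//=.
rewrite mulr_ile1 ?sqr_ge0// => /(_ isT).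
by move: Np; lra.
Qed.

(** [assouad] applied to [e] times the expected miss, with [delta = e * (p / 4)]; the 8 is this 4
    times the 2 of the averaging. *)
Lemma classifier_excess_ge s : (forall v, (excess_risk (cell_model v) g <= s)%E) ->
  ((e * #|K|%:R * p / 8)%:E <= s)%E.
Proof.
have /andP[e0 e1] := e01.
have I0 v k : (0 <= miss_int v k)%E by apply: integral_ge0 => w _.
have Ifin v k : miss_int v k \is a fin_num.
  rewrite ge0_fin_numE// (@le_lt_trans _ _ p%:E) ?ltry//.
  apply: (@le_trans _ _ (\int[P v]_w p%:E)%E).
    apply: ge0_le_integral => //.
    by move=> w _; rewrite -(missD k (v k) w) leeDl.
  by rewrite integral_power_cst.
have G v : (excess_risk (cell_model v) g = (\sum_k e * fine (miss_int v k))%:E)%E.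
  rewrite excessE -sumEFin; apply: eq_bigr => k _.
  by rewrite EFinM fineK.
move=> Hs; have v0 : {ffun K -> bool} by exact: [ffun=> true].
(* A bound [+oo] makes the claim trivial, and [-oo] cannot bound the finite excess risk of the model
   at [v0]. *)
case: s Hs => [r| |] Hs; [|by rewrite leey|].
  rewrite lee_fin; have := @assouad R K (fun v k => e * fine (miss_int v k))
    (e * (p / 4)) r.
  rewrite (_ : _ / 8 = #|K|%:R * (e * (p / 4) / 2)); last by field.
  apply.
  - move=> v k; rewrite -mulrDr ler_wpM2l// -lee_fin EFinD !fineK//.
  - by move=> v; rewrite -lee_fin -G.
by have := Hs v0; rewrite G.
Qed.

End classifier_bound.

Lemma minimax_ge (S : set (model R d)) N p :
  (forall k, (\int[L]_(x in Q k) (f x)%:E = p%:E)%E) ->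
  N%:R * (e ^+ 2 * p) <= 4^-1 -> (forall v, S (cell_model v)) ->
  ((e * #|K|%:R * p / 8)%:E <= minimax_excess_risk S N)%E.
Proof.
move=> pE Np Sv; apply: le_ereal_inf_tmp => _ [g mg <-].
apply: (classifier_excess_ge pE Np mg) => v.
by apply: ereal_sup_ubound; exists (cell_model v).
Qed.

End minimax.

(** * Cubes and norms *)

Lemma measurable_exists d (T : measurableType d) (I : countType) (F : I -> set T) :
  (forall i, measurable (F i)) -> measurable [set x | exists i, F i x].
Proof.
move=> mF; rewrite (_ : [set x | _] =
    \bigcup_n (if unpickle n is Some i then F i else set0)).
  by apply: bigcup_measurable => n _; case: unpickle.
apply/seteqP; split => [x [i Fix]|x [n _]] /=.
  by exists (pickle i) => //; rewrite pickleK.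
by case: unpickle => // i Fix; exists i.
Qed.

Section cubes.
Context (R : realType) (d : nat).
Local Notation X := ('rV[R]_d).

(** Closed, so that the support of a density carried by finitely many cubes stays inside their
    union. *)
Definition cube (c : 'I_d -> R) (s : R) : set X :=
  [set x | forall i, c i <= x ord0 i <= c i + s].

Lemma cubeE c s : cube c s =
  [set x | forall i, ((fun y : X => y ord0 i) @^-1` `[c i, c i + s]%classic) x].
Proof. by apply/seteqP; split => x /= cx i; have := cx i; rewrite in_itv. Qed.

Lemma measurable_coord (i : 'I_d) : measurable_fun [set: X] (fun x => x ord0 i).
Proof.
move=> _ Y mY; rewrite setTI; apply: sub_sigma_algebra => /=.
rewrite -bigcup_seq/=; exists i => /=; first by rewrite mem_index_enum.
by exists Y => //; rewrite setTI.
Qed.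

Lemma measurable_cube c s : measurable (cube c s).
Proof.
rewrite cubeE; apply: measurable_forall => i.
by rewrite -[X in measurable X]setTI; exact: measurable_coord.
Qed.

Lemma closed_cube c s : closed (cube c s).
Proof.
rewrite cubeE (_ : [set x | _] = \bigcap_i
    ((fun y : X => y ord0 i) @^-1` `[c i, c i + s]%classic)); last first.
  by apply/seteqP; split => x /= H i => [_|]; exact: H.
apply: closed_bigI => i _; apply: (@continuous_closedP _ _ _).1.
  exact: coord_continuous.
exact: itv_closed.
Qed.

Lemma lebesgue_cube c s : 0 <= s -> lebesgue_rV (cube c s) = (s ^+ d)%:E.
Proof.
move=> s0; rewrite /lebesgue_rV /pushforward.
rewrite (_ : _ @^-1` _ =
    [set t : d.-tuple R | forall i, `[c i, c i + s]%classic (tnth t i)]); last first.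
  by apply/seteqP; split => t /= ct i; have := ct i; rewrite ?mxE ?in_itv// mxE.
apply: etrans.
  by apply: (@power_measure_box R _ _ (@lebesgue_measure R) d
    (fun i => `[c i, c i + s]%classic)) => i; exact: measurable_itv.
rewrite (eq_bigr (fun=> s%:E)); last first.
  move=> i _ /=; rewrite lebesgue_measure_itv/= lte_fin.
  rewrite -EFinD; case: ltP => [_|]; first by congr EFin; ring.
  by move=> ?; congr EFin; lra.
by rewrite prodEFin prodr_const card_ord.
Qed.

(** The corner [x - s], clipped from below at [c]: the clipped cube cannot leave [cube c w] above
    because [x] lies in it and [s <= w]. *)
Lemma subcube c w (x : X) s : 0 <= s <= w -> cube c w x ->
  exists2 c', cube c' s `<=` cube c w &
    cube c' s `<=` cube (fun i => x ord0 i - s) (s + s).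
Proof.
move=> /andP[s0 sw] cx.
exists (fun i => Num.max (c i) (x ord0 i - s)) => y /= cy i.
  by have := cy i; have := cx i; case: (leP (c i) (x ord0 i - s)) => ?; lra.
by have := cy i; have := cx i; case: (leP (c i) (x ord0 i - s)) => ?; lra.
Qed.

End cubes.

(** * Comparison of an arbitrary norm with the sup norm *)

Section norms.
Context (R : realType) (d : nat) (nrm : 'rV[R]_d -> R).
Hypothesis nrm_norm : is_norm nrm.
Local Notation X := ('rV[R]_d).

Lemma is_norm0 : nrm 0 = 0.
Proof. by case: nrm_norm => _ nZ _; rewrite -(scale0r 0) nZ normr0 mul0r. Qed.

Lemma is_normN x : nrm (- x) = nrm x.
Proof. by case: nrm_norm => _ nZ _; rewrite -scaleN1r nZ normrN1 mul1r. Qed.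

Lemma is_norm_ge0 x : 0 <= nrm x.
Proof.
case: nrm_norm => _ _ nD; have := nD x (- x).
by rewrite subrr is_norm0 is_normN; lra.
Qed.

Lemma is_norm_sum (I : Type) (r : seq I) (F : I -> X) :
  nrm (\sum_(i <- r) F i) <= \sum_(i <- r) nrm (F i).
Proof.
case: nrm_norm => _ _ nD; elim: r => [|i r IH]; first by rewrite !big_nil is_norm0.
by rewrite !big_cons (le_trans (nD _ _))// lerD2l.
Qed.

(** Expansion in the standard basis; the added 1 makes positivity of the constant immediate. *)
Lemma is_norm_le : exists2 C : R, 0 < C &
  forall (x : X) s, 0 <= s -> (forall i, `|x ord0 i| <= s) -> nrm x <= C * s.
Proof.
have [_ nZ nD] := nrm_norm.
exists (\sum_i nrm (delta_mx ord0 i) + 1) => [|x s s0 xs].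
  by rewrite ltr_wpDl// sumr_ge0// => i _; exact: is_norm_ge0.
rewrite [x]row_sum_delta (le_trans (is_norm_sum _ _))//.
rewrite mulrDl mul1r ler_wpDr// mulr_suml; apply: ler_sum => i _.
by rewrite nZ mulrC ler_wpM2l// is_norm_ge0.
Qed.

Lemma is_norm_dist x y : `|nrm x - nrm y| <= nrm (x - y).
Proof.
have [_ _ nD] := nrm_norm.
have := nD (x - y) y; have := nD (y - x) x; rewrite !subrK -(is_normN (x - y)) opprB.
by rewrite ler_norml; lra.
Qed.

Lemma is_norm_continuous : continuous nrm.
Proof.
have [C C0 nC] := is_norm_le.
move=> x; apply/(@cvgrPdist_lt _ _ _ _ (nbhs_filter (x : X))) => e e0.
have e' : 0 < e / (2 * C) by rewrite divr_gt0// mulr_gt0.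
apply/nbhs_ballP; exists (e / (2 * C)) => //= y [_ xy].
apply: (le_lt_trans (is_norm_dist _ _)).
apply: (@le_lt_trans _ _ (C * (e / (2 * C)))).
  apply: nC; first exact: ltW.
  by move=> i; rewrite !mxE; exact/ltW/xy.
rewrite (_ : C * _ = e / 2); last by field; rewrite gt_eqF.
by lra.
Qed.

(* After scaling, [x] lies on a face of the unit cube, which is compact; the norm
   has a positive minimum on each of the finitely many faces. *)
Lemma coord_le_is_norm : exists2 C : R, 0 < C &
  forall (x : X) i, `|x ord0 i| <= C * nrm x.
Proof.
have [n0 nZ nD] := nrm_norm.
(* Only faces on which a coordinate equals 1 are needed, since a vector is divided by its largest
   coordinate with its sign. *)
pose A (i j : 'I_d) : set R := if j == i then [set 1] else `[-1, 1]%classic.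
pose K i : set X := [set x | forall j, A i j (x ord0 j)].
have cK i : compact (K i).
  apply: rV_compact => j; rewrite /A; case: ifP => _; first exact: compact_set1.
  exact: segment_compact.
have K0 i : K i !=set0.
  exists (delta_mx ord0 i) => j; rewrite /A mxE eqxx/=.
  by case: eqP => [_|_]/=; rewrite ?in_itv/= ?lerN10 ?ler01.
have Kpos i : exists2 m : R, 0 < m & forall x, K i x -> m <= nrm x.
  have [c cK' Hc] := @EVT_min_rV R d nrm (K i) (K0 i) (cK i)
    (continuous_subspaceT is_norm_continuous).
  exists (nrm c) => [|x Kx]; last by apply: Hc; rewrite inE.
  rewrite lt_neqAle is_norm_ge0 andbT; apply/eqP => /esym/n0 c0.
  move: cK'; rewrite inE => /(_ i); rewrite /A eqxx c0 mxE => /eqP.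
  by rewrite eq_sym oner_eq0.
have /choice[m Hm] : forall i, exists m : R, 0 < m /\ forall x, K i x -> m <= nrm x.
  by move=> i; have [m ? ?] := Kpos i; exists m.
pose C := \sum_i (m i)^-1.
have mC i : (m i)^-1 <= C.
  rewrite /C (bigD1 i)//= lerDl; apply: sumr_ge0 => j _.
  by rewrite invr_ge0 ltW//; have [] := Hm j.
exists (C + 1) => [|x i].
  rewrite ltr_wpDl//; apply: sumr_ge0 => j _.
  by rewrite invr_ge0 ltW//; have [] := Hm j.
have [k Hk] : exists k, forall j, `|x ord0 j| <= `|x ord0 k|.
  have [k _ kP] := @arg_maxP _ _ 'I_d i xpredT (fun j => `|x ord0 j|) isT.
  by exists k => j; exact: kP.
apply: (le_trans (Hk i)).
have [m0 mK] := Hm k.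
have [xk0|xk0] := eqVneq (x ord0 k) 0.
  rewrite xk0 normr0 mulr_ge0 ?is_norm_ge0//.
  by rewrite (le_trans _ (ler_wpDr _ (mC k)))// invr_ge0 ltW.
have /mK : K k ((x ord0 k)^-1 *: x).
  move=> j; rewrite /A mxE; case: eqP => [->|_] /=; first by rewrite mulVf.
  rewrite in_itv/= -ler_norml normrM normfV ler_pdivrMl ?normr_gt0// mulr1.
  exact: Hk.
rewrite nZ normfV ler_pdivlMl ?normr_gt0// => H.
apply: (@le_trans _ _ ((m k)^-1 * nrm x)); first by rewrite ler_pdivlMl// mulrC.
by rewrite ler_wpM2r ?is_norm_ge0// (le_trans (mC k))// lerDl.
Qed.

(* Borel sets being the product ones, a ball is written as a countable union of
   cubes with rational centers. *)
Lemma measurable_nball x r : measurable (nball nrm x r).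
Proof.
have [C C0 nC] := is_norm_le; have [_ _ nD] := nrm_norm.
pose q (w : {ffun 'I_d -> rat}) : X := \row_i ratr (w i).
pose F (p : {ffun 'I_d -> rat} * nat) : set X :=
  if nrm (q p.1) + C * p.2.+1%:R^-1 < r then
    cube (fun i => x ord0 i + q p.1 ord0 i - p.2.+1%:R^-1) (p.2.+1%:R^-1 *+ 2)
  else set0.
rewrite (_ : nball nrm x r = [set y | exists p, F p y]).
  by apply: measurable_exists => p; rewrite /F; case: ifP => // _; exact: measurable_cube.
apply/seteqP; split => y /=; last first.
  move=> [p]; rewrite /F; case: ifPn => // pr cy.
  apply: le_lt_trans pr; rewrite /nball/=.
  rewrite (_ : y - x = q p.1 + (y - x - q p.1)); last by rewrite [RHS]addrC subrK.
  rewrite (le_trans (nD _ _))// lerD2l; apply: nC; first by rewrite invr_ge0.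
  move=> i; have := cy i; rewrite !mxE ler_norml.
  set D := _^-1; lra.
(* A mesh below [e] spends less than half of the slack [r - nrm (y - x)] on moving from [y - x] to a
   rational center, and less than half on the cube around that center. *)
move=> yr; pose e := (r - nrm (y - x)) / (2 * C).
have e0 : 0 < e by rewrite divr_gt0 ?subr_gt0// mulr_gt0.
have [k ke] : exists k : nat, k.+1%:R^-1 < e.
  have [k _ Hk] := @near_infty_natSinv_lt R (PosNum e0).
  by exists k; exact: (Hk k (leqnn k)).
have k0 : 0 < k.+1%:R^-1 :> R by rewrite invr_gt0.
have /choice[w Hw] : forall i, exists w : rat,
    `|(y - x) ord0 i - ratr w| <= k.+1%:R^-1.
  move=> i.
  have [|w] := @rat_in_itvoo R ((y - x) ord0 i - k.+1%:R^-1) ((y - x) ord0 i).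
    by rewrite ltrBlDr ltrDl.
  rewrite in_itv/= => H; exists w; rewrite ler_norml.
  by move: k0 H; set D := _^-1; set z := _ ord0 i; lra.
have Hn : nrm (q [ffun i => w i] - (y - x)) <= C * k.+1%:R^-1.
  apply: nC; first exact: ltW.
  by move=> i; have := Hw i; rewrite !mxE ffunE distrC.
exists ([ffun i => w i], k); rewrite /F ifT/=.
  move=> i; have := Hw i; rewrite !mxE ffunE ler_norml mulr2n.
  set D := _^-1; lra.
have := nD (q [ffun i => w i] - (y - x)) (y - x); rewrite subrK.
have : C * k.+1%:R^-1 < C * e by rewrite ltr_pM2l.
have -> : C * e = (r - nrm (y - x)) / 2 by rewrite /e; field; rewrite gt_eqF.
by move: Hn; set D := C / _; set n1 := nrm (q _ - _); set n2 := nrm (q _); lra.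
Qed.

End norms.

(** * Models that are constant on separated cubes *)

Lemma measurable_set_bool d (T : measurableType d) (b : T -> bool) :
  measurable_fun setT b -> measurable [set x | b x].
Proof.
by move=> mb; rewrite -[X in measurable X]setTI; exact: (mb measurableT [set true]).
Qed.

Lemma integral_sum_indic d (T : measurableType d) (R : realType)
    (mu : {measure set T -> \bar R}) (J : finType) (Q : J -> set T) (a : J -> R) A :
  (forall j, measurable (Q j)) -> (forall j, 0 <= a j) -> measurable A ->
  (\int[mu]_(x in A) (\sum_j a j * \1_(Q j) x)%:E =
   \sum_j (a j)%:E * mu (Q j `&` A))%E.
Proof.
move=> mQ a0 mA.
have mi j : measurable_fun A (fun x => (a j * \1_(Q j) x)%:E).
  by apply/measurable_EFinP; apply: measurable_funM.
under eq_integral do rewrite -sumEFin.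
rewrite ge0_integral_sum//; last by move=> j x _; rewrite lee_fin mulr_ge0.
apply: eq_bigr => j _.
under eq_integral do rewrite EFinM.
rewrite ge0_integralZl//; last by rewrite lee_fin.
  by rewrite integral_indic.
exact/measurable_EFinP.
Qed.

(** * Volume of the part of a set inside a cube *)

Section cube_vol.
Context (R : realType) (d : nat).
Local Notation X := ('rV[R]_d).
Local Notation L := (@lebesgue_rV R d).
Implicit Types (c : 'I_d -> R) (w s : R) (A B : set X).

Definition sup_ball (x : X) s : set X := cube (fun i => x ord0 i - s) (s + s).

Lemma measurable_sup_ball x s : measurable (sup_ball x s).
Proof. exact: measurable_cube. Qed.

Definition cube_vol c w A : R := fine (L (cube c w `&` A)).

Let measurable_cubeI c w A : measurable A -> measurable (cube c w `&` A).
Proof. by move=> mA; apply: measurableI => //; exact: measurable_cube. Qed.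

Lemma cube_volE c w A : 0 <= w -> measurable A ->
  L (cube c w `&` A) = (cube_vol c w A)%:E.
Proof.
move=> w0 mA; rewrite /cube_vol fineK// ge0_fin_numE//.
rewrite (@le_lt_trans _ _ (L (cube c w)))//; last by rewrite lebesgue_cube ?ltry.
by apply: le_measure; rewrite ?inE//; [exact: measurable_cubeI|exact: measurable_cube].
Qed.

Lemma cube_vol_ge0 c w A : 0 <= cube_vol c w A.
Proof. exact: fine_ge0. Qed.

Lemma cube_vol_mono c w A B : 0 <= w -> measurable A -> measurable B ->
  A `<=` B -> cube_vol c w A <= cube_vol c w B.
Proof.
move=> w0 mA mB AB; rewrite -lee_fin -!cube_volE//.
by apply: le_measure; rewrite ?inE//; [exact: measurable_cubeI..|exact: setIS].
Qed.

Lemma cube_vol_le c w A : 0 <= w -> measurable A -> cube_vol c w A <= w ^+ d.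
Proof.
move=> w0 mA; rewrite -lee_fin -cube_volE// -(lebesgue_cube c)//.
by apply: le_measure; rewrite ?inE//; [exact: measurable_cubeI|exact: measurable_cube].
Qed.

Lemma cube_vol_id c w A : 0 <= w -> measurable A -> cube c w `<=` A ->
  cube_vol c w A = w ^+ d.
Proof. by move=> w0 mA /setIidPl cA; rewrite /cube_vol cA lebesgue_cube. Qed.

(** The worst position of [x] is a corner of the cube, where one orthant of the sup ball remains;
    hence [s ^+ d] and not [(2 s) ^+ d]. *)
Lemma cube_vol_ge c w x s : 0 <= s <= w -> cube c w x ->
  s ^+ d <= cube_vol c w (sup_ball x s).
Proof.
move=> sw Qx; have /andP[s0 ?] := sw; have [c' c'Q c'x] := subcube sw Qx.
rewrite -lee_fin -cube_volE; [|exact: le_trans s0 _|exact: measurable_sup_ball].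
rewrite -(lebesgue_cube c' s0); apply: le_measure; rewrite ?inE.
- exact: measurable_cube.
- by apply: measurable_cubeI; exact: measurable_sup_ball.
- by move=> y c'y; split; [exact: c'Q|exact: c'x].
Qed.

End cube_vol.

(** * Conditions (a)-(d) for densities that are constant on separated cubes *)

Section cube_model.
Context (R : realType) (d : nat).
Local Notation X := ('rV[R]_d).
Local Notation L := (@lebesgue_rV R d).
Variables (J : finType) (c : J -> 'I_d -> R) (w u eps : J -> R) (D : pair_data R d).
Local Notation Q j := (cube (c j) (w j)).
Hypothesis w0 : forall j, 0 < w j.
Hypothesis u0 : forall j, 0 < u j.
Hypothesis fE : forall x, pd_f D x = \sum_j u j * \1_(Q j) x.
Hypothesis etaE : forall j x, Q j x -> pd_eta D x = eps j.
Variable h : R.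
Hypothesis h0 : 0 < h.
Hypothesis Qsep : forall i j x y, Q i x -> Q j y -> i != j ->
  exists l, h <= `|x ord0 l - y ord0 l|.
Hypothesis epsE : forall j, eps j = 0 \/ `|eps j| = h ^+ 2.

Local Notation vol j A := (cube_vol (c j) (w j) A).

Let P (A : set X) : \bar R := pair_law D (fst @^-1` A).
Lemma cube_disjoint i j x : Q i x -> Q j x -> i = j.
Proof.
move=> Qi Qj; apply/eqP; apply: contraT => ij.
by have [l] := Qsep Qi Qj ij; rewrite subrr normr0 leNgt h0.
Qed.

Let integral_cubes A (a : J -> R) : measurable A -> (forall j, 0 <= a j) ->
  (\int[L]_(x in A) (\sum_j a j * \1_(Q j) x)%:E = (\sum_j a j * vol j A)%:E)%E.
Proof.
move=> mA a0.
rewrite (integral_sum_indic _ (fun j => measurable_cube (c j) (w j)) a0 mA).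
rewrite -sumEFin; apply: eq_bigr => j _; rewrite EFinM; congr (_ * _)%E.
by apply: cube_volE => //; exact: ltW.
Qed.

Let PE A : measurable A -> P A = (\sum_j u j * vol j A)%:E.
Proof.
move=> mA; rewrite /P pair_law_fst// -integral_cubes//; last by move=> j; exact: ltW.
by apply: eq_integral => x _; rewrite fE.
Qed.

Let f_in j x : Q j x -> pd_f D x = u j.
Proof.
by move=> Qx; rewrite fE (@sum_indic_in _ _ _ (fun j => Q j) cube_disjoint _ j).
Qed.

Let f_out x : (forall j, ~ Q j x) -> pd_f D x = 0.
Proof.
by move=> Qx; rewrite fE (@sum_indic_out _ _ _ (fun j => Q j)).
Qed.

Let cube_cases x : (exists j, Q j x) \/ (forall j, ~ Q j x).
Proof. by have [?|/forallNP ?] := pselect (exists j, Q j x); [left|right]. Qed.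

Let eps_le j : `|eps j| <= h ^+ 2.
Proof. by case: (epsE j) => ->; rewrite ?normr0 ?sqr_ge0. Qed.

Let label_integral A : measurable A ->
  (\int[pair_law D]_(z in fst @^-1` A) (label z.2)%:E =
   (\sum_j u j * eps j * vol j A)%:E)%E.
Proof.
move=> mA.
have mA' : measurable (fst @^-1` A : set (X * bool)).
  by rewrite -[X in measurable X]setTI; exact: measurable_fst.
have ml : measurable_fun [set: X * bool] (fun z => @label R z.2).
  exact: measurableT_comp (@measurable_label R) measurable_snd.
rewrite (@integral_shift1 _ _ _ _ _ (fun z => label z.2))//; last first.
  by move=> z; exact: label_le1.
rewrite (@pair_law_integral _ _ _ _ (fun z => 1 + label z.2))//; last 2 first.
- exact: measurable_funD.
- by move=> z; have := label_le1 R z.2; rewrite ler_norml => /andP[]; lra.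
have e1 j : 0 <= 1 + eps j.
  (* The corner of the cube is a point at which the bound on [pd_eta] can be read as a bound on
     [eps j]. *)
  have Qc : Q j (\row_i c j i) by move=> i; rewrite mxE lexx lerDl ltW.
  have := pd_eta_le1 D (\row_i c j i); rewrite (etaE Qc) ler_norml => /andP[].
  by lra.
transitivity (\int[L]_(x in A) (\sum_j (u j * (1 + eps j)) * \1_(Q j) x)%:E - P A)%E.
  congr (_ - _)%E; apply: eq_integral => x _; congr EFin.
  have [[j Qj]|Qx] := cube_cases x.
    rewrite (@sum_indic_in _ _ _ (fun j => Q j) cube_disjoint _ j)//.
    by rewrite (f_in Qj) (etaE Qj) /label/=; field.
  by rewrite (@sum_indic_out _ _ _ (fun j => Q j))// f_out// mul0r.
rewrite integral_cubes//; last by move=> j; rewrite mulr_ge0// ltW.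
rewrite PE// -EFinB -sumrB; congr EFin; apply: eq_bigr => j _; ring.
Qed.

(** All the mass lies on the cubes, and those violating [q] do not meet [S]; each of the others is
    counted in full. *)
Let P_le (S : set X) (q : pred J) (B : R) : measurable S ->
  (forall j x, S x -> Q j x -> q j) ->
  \sum_(j | q j) u j * w j ^+ d <= B -> (P S <= B%:E)%E.
Proof.
move=> mS Sq; rewrite PE// lee_fin; apply: le_trans.
rewrite [leLHS](bigID q)/= [X in _ + X <= _]big1 ?addr0.
  by apply: ler_sum => j _; rewrite ler_wpM2l ?cube_vol_le// ltW.
move=> j nq; rewrite /cube_vol (_ : Q j `&` S = set0) ?measure0 ?mulr0//.
by rewrite -subset0 => x [Qx Sx]; move: nq; rewrite (Sq j x).
Qed.

Variables (nrm : X -> R) (nrm_norm : is_norm nrm).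
Variables (C1 C2 : R) (C1_gt0 : 0 < C1) (C2_gt0 : 0 < C2).
Hypothesis nrm_coord : forall (x : X) i, `|x ord0 i| <= C1 * nrm x.
Hypothesis nrm_le : forall (x : X) s, 0 <= s ->
  (forall i, `|x ord0 i| <= s) -> nrm x <= C2 * s.

Let sup_ball_nball x r s : 0 <= s -> C2 * s < r -> sup_ball x s `<=` nball nrm x r.
Proof.
move=> s0 sr y xy; apply: le_lt_trans sr; apply: nrm_le => // i.
by have /= := xy i; rewrite !mxE ler_norml; lra.
Qed.

Let nball_sup_ball x r : nball nrm x r `<=` sup_ball x (C1 * r).
Proof.
move=> y xy i; have := nrm_coord (y - x) i; rewrite !mxE ler_norml.
have : C1 * nrm (y - x) < C1 * r by rewrite ltr_pM2l.
by move=> ? /andP[]; lra.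
Qed.

Let mball x r : measurable (nball nrm x r). Proof. exact: measurable_nball. Qed.

Let vol_nball_gt0 j x r : 0 < r -> Q j x -> 0 < vol j (nball nrm x r).
Proof.
move=> r0 Qx; pose s := Num.min (w j) (r / (2 * C2)).
have s0 : 0 < s by rewrite lt_min w0 divr_gt0// mulr_gt0.
have sw : 0 <= s <= w j by rewrite ltW//= ge_min lexx.
apply: lt_le_trans
  (cube_vol_mono (c j) (ltW (w0 j)) (measurable_sup_ball x s) (mball x r) _).
  by apply: lt_le_trans (cube_vol_ge sw Qx); rewrite exprn_gt0.
apply: sup_ball_nball; first exact: ltW.
apply: (@le_lt_trans _ _ (C2 * (r / (2 * C2)))).
  by rewrite ler_pM2l// ge_min lexx orbT.
have -> : C2 * (r / (2 * C2)) = r / 2 by field; rewrite gt_eqF.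
by rewrite ltr_pdivrMr// ltr_pMr// ltr1n.
Qed.

Let support_cubes x : density_support (pair_model D) x -> exists j, Q j x.
Proof.
have cl : closed (\bigcup_j Q j).
  by apply: closed_bigcup; [exact: finite_finset|move=> j _; exact: closed_cube].
have sub : density_support (pair_model D) `<=` \bigcup_j Q j.
  rewrite [X in _ `<=` X]((closure_id _).1 cl); apply: closureS => y /=.
  by have [[j Qy]|Qy] := cube_cases y; [exists j|rewrite f_out ?eqxx].
by move=> /sub[j _ Qx]; exists j.
Qed.

(** If [C1 * r <= h], the separation keeps every other cube out of the ball, and the average is
    exactly [eps j]. Otherwise the average and the value are both at most [h ^+ 2 <= (C1 * r) ^+ 2]
    in absolute value, whence the factor 2. *)
Let cube_smooth x r : 0 < r -> density_support (pair_model D) x ->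
  `|regression_on (pair_model D) (nball nrm x r) - pd_eta D x|
    <= 2 * C1 ^+ 2 * r ^+ 2.
Proof.
move=> r0 /support_cubes[j Qx]; rewrite (etaE Qx).
set B := nball nrm x r; have mB : measurable B by exact: mball.
have PB : fine (prX (pair_model D) B) = \sum_i u i * vol i B.
  by rewrite /prX [law _ _](PE mB).
rewrite /regression_on PB /Rintegral.
rewrite [X in fine X](label_integral mB)/=.
have [rh|hr] := leP (C1 * r) h.
  have v0 i : i != j -> vol i B = 0.
    move=> ij; rewrite /cube_vol (_ : Q i `&` B = set0) ?measure0//.
    rewrite -subset0 => y [Qy By].
    have [l] := Qsep Qy Qx ij; apply/negP; rewrite -ltNge.
    have := nrm_coord (y - x) l; rewrite !mxE => /le_lt_trans; apply.
    by apply: lt_le_trans rh; rewrite ltr_pM2l.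
  rewrite (bigD1 j)//= big1 ?addr0 => [|i ij]; last by rewrite v0// mulr0.
  rewrite (bigD1 j)//= big1 ?addr0 => [|i ij]; last by rewrite v0// mulr0.
  have uv : u j * vol j B != 0.
    by rewrite mulf_neq0// gt_eqF// vol_nball_gt0.
  rewrite [u j * eps j]mulrC -(mulrA (eps j)) mulfK// subrr normr0.
  by apply: mulr_ge0; rewrite ?sqr_ge0// mulr_ge0 ?sqr_ge0.
apply: (@le_trans _ _ (h ^+ 2 + h ^+ 2)).
  rewrite (le_trans (ler_normB _ _))// lerD//.
  set S := \sum_i u i * vol i B.
  have S0 : 0 <= S by apply: sumr_ge0 => i _; rewrite mulr_ge0 ?cube_vol_ge0// ltW.
  have SS : `|\sum_i u i * eps i * vol i B| <= h ^+ 2 * S.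
    rewrite (le_trans (ler_norm_sum _ _ _))// /S mulr_sumr; apply: ler_sum => i _.
    rewrite -mulrA mulrCA normrM ler_pM ?normr_ge0//.
    by rewrite ger0_norm// mulr_ge0 ?cube_vol_ge0// ltW.
  (* A vanishing denominator is harmless here: division by 0 returns 0. *)
  have [S_eq0|S_neq0] := eqVneq S 0; first by rewrite S_eq0 invr0 mulr0 normr0 sqr_ge0.
  have S_gt0 : 0 < S by rewrite lt_neqAle eq_sym S_neq0.
  by rewrite normrM normfV (gtr0_norm S_gt0) ler_pdivrMr.
have : h ^+ 2 <= (C1 * r) ^+ 2 by rewrite ler_pXn2r// ?nnegrE ltW// mulr_gt0.
by rewrite exprMn; lra.
Qed.

Variables (alpha beta A B kappa : R).
Hypothesis A0 : 0 <= A.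
Hypothesis alpha0 : 0 < alpha.
Hypothesis kappa0 : 0 < kappa.
Hypothesis Qmargin : \sum_(j | eps j != 0) u j * w j ^+ d <= A * (h ^+ 2) `^ alpha.
Hypothesis Qtail : forall t, 0 < t ->
  \sum_(j | u j <= t) u j * w j ^+ d <= B * t `^ beta.
Hypothesis Qmass : forall j x s, Q j x -> 0 < s <= 1 ->
  kappa * u j * s ^+ d <= \sum_i u i * vol i (sup_ball x s).

(** Margin: nonzero values of [eta] have size [h ^+ 2], so nothing is charged below that level, and
    above it [Qmargin] and monotonicity of the power suffice. Tail: the density takes only the
    values [u j] on the cubes. Minimal mass: [Qmass] for sup balls is transferred to the norm by
    squeezing [nball] between two sup balls. *)
Lemma cube_model_assumptions Ca Cb Cc Cd D0 : A <= Ca -> B <= Cb ->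
  2 * C1 ^+ 2 <= Cc -> 0 < Cd <= kappa / (4 * C1 * C2) ^+ d -> 0 < D0 <= 2 * C2 ->
  assumptions nrm alpha beta Ca Cb Cc Cd D0 (pair_model D).
Proof.
move=> ACa BCb CCc /andP[Cd0 Cdk] /andP[D00 D0C]; split.
- move=> t t0; rewrite /prX [law _ _]/=.
  have mS : measurable [set x | 0 < `|pd_eta D x| <= t].
    rewrite (_ : [set x | _] =
        [set x | 0 < `|pd_eta D x|] `&` [set x | `|pd_eta D x| <= t]).
      have mn : measurable_fun setT (fun x => `|pd_eta D x|).
        exact: measurableT_comp (@normr_measurable _ _) (measurable_pd_eta D).
      apply: measurableI; apply: measurable_set_bool.
        exact: (@measurable_fun_ltr _ _ _ _ (cst 0)).
      exact: (@measurable_fun_ler _ _ _ _ _ (cst t)).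
    by apply/seteqP; split => x /=; [move=> /andP[]|case=> -> ->].
  have [th|ht] := ltP t (h ^+ 2).
    apply: (@P_le _ pred0) => //.
      move=> j x /= /andP[e_gt0 e_le] Qx; exfalso.
      move: e_gt0 e_le; rewrite (etaE Qx); case: (epsE j) => ->.
        by rewrite normr0 ltxx.
      by rewrite leNgt th.
    by rewrite big_pred0// mulr_ge0 ?powR_ge0// (le_trans A0).
  apply: (@P_le _ (fun j => eps j != 0)) => //.
    by move=> j x /= /andP[e_gt0 _] Qx; rewrite -(etaE Qx) -normr_gt0.
  apply: (le_trans Qmargin); apply: ler_pM => //; first exact: powR_ge0.
  apply: ge0_ler_powR; rewrite ?nnegrE ?sqr_ge0//; first exact: ltW.
  exact: ltW.
- move=> t t0; rewrite /prX [law _ _]/=.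
  have mS : measurable [set x | pd_f D x <= t].
    apply: measurable_set_bool.
    exact: (@measurable_fun_ler _ _ _ _ _ (cst t) (measurable_pd_f D)).
  apply: (@P_le _ (fun j => u j <= t)) => //.
    by move=> j x /= fx Qx; rewrite -(f_in Qx).
  by apply: (le_trans (Qtail t0)); rewrite ler_wpM2r// powR_ge0.
- move=> r x r0 sx; apply: (le_trans (cube_smooth r0 sx)).
  by rewrite ler_wpM2r// sqr_ge0.
- move=> x r /andP[r0 rD]; rewrite /prX /=.
  have [[j Qx]|Qx] := cube_cases x; last first.
    by rewrite f_out// mulr0 mul0e measure_ge0.
  rewrite (f_in Qx).
  have C1r : 0 <= C1 * r by rewrite mulr_ge0// ltW.
  have LB : (lebesgue_rV (nball nrm x r) <= ((2 * (C1 * r)) ^+ d)%:E)%E.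
    rewrite mulr_natl -(lebesgue_cube (fun i => x ord0 i - C1 * r)); last first.
      by rewrite mulrn_wge0.
    by apply: le_measure; rewrite ?inE//; exact: measurable_cube.
  apply: (@le_trans _ _ ((Cd * u j)%:E * ((2 * (C1 * r)) ^+ d)%:E)%E).
    by rewrite lee_wpmul2l// lee_fin mulr_ge0// ltW.
  (* The sup ball of radius [s] fits strictly inside the norm ball, and [D0 <= 2 * C2] gives
     [s <= 1]. The outer sup ball has side [2 * (C1 * r) = 4 * C1 * C2 * s], which explains the
     bound on [Cd]. *)
  pose s := r / (2 * C2).
  have s01 : 0 < s <= 1.
    rewrite divr_gt0 ?mulr_gt0//= ler_pdivrMr ?mulr_gt0// mul1r.
    by rewrite (le_trans (ltW rD)).
  have /andP[s0 s1] := s01.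
  rewrite [leRHS](PE (mball x r)) -EFinM lee_fin.
  apply: (@le_trans _ _ (kappa * u j * s ^+ d)).
    have -> : 2 * (C1 * r) = 4 * C1 * C2 * s by rewrite /s; field; rewrite gt_eqF.
    rewrite exprMn mulrA ler_wpM2r ?exprn_ge0 ?(ltW s0)//.
    rewrite mulrAC ler_wpM2r ?(ltW (u0 j))//.
    by rewrite -ler_pdivlMr// exprn_gt0// !mulr_gt0.
  apply: (le_trans (Qmass Qx s01)); apply: ler_sum => i _.
  rewrite ler_wpM2l ?(ltW (u0 i))//; apply: cube_vol_mono => //.
  - exact: ltW.
  - exact: measurable_sup_ball.
  apply: sup_ball_nball; first exact: ltW.
  have -> : C2 * s = r / 2 by rewrite /s; field; rewrite gt_eqF.
  by rewrite ltr_pdivrMr// ltr_pMr// ltr1n.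
Qed.

End cube_model.

(** * The grid construction *)

Lemma nat_gap (R : realDomainType) (m n : nat) : m != n ->
  m%:R + 1 <= n%:R :> R \/ n%:R + 1 <= m%:R :> R.
Proof.
by rewrite neq_ltn => /orP[|] mn; [left|right]; rewrite natr1 ler_nat.
Qed.

(** A window of [n] consecutive indices below [M] starts at [k], or is moved back to [M - n] when it
    would overrun. This lemma and the next two say that it stays in range and that its indices
    differ from [k] by less than [n]. *)
Lemma window_lt (k n M p : nat) : (p < n)%N -> (n <= M)%N ->
  (minn k (M - n) + p < M)%N.
Proof. lia. Qed.

Lemma window_le (k n M p : nat) : (p < n)%N -> (minn k (M - n) + p + 1 <= k + n)%N.
Proof. lia. Qed.

Lemma window_ge (k n M p : nat) : (k < M)%N -> (0 < n)%N -> (n <= M)%N ->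
  (k + 1 <= minn k (M - n) + p + n)%N.
Proof. lia. Qed.

Lemma ler_sum_inj (R : numDomainType) (I J : finType) (f : I -> J) (F : J -> R) :
  injective f -> (forall j, 0 <= F j) -> \sum_i F (f i) <= \sum_j F j.
Proof.
move=> f_inj F0.
rewrite [leRHS](bigID (mem (f @: predT)%SET))/= big_imset/=; last first.
  by move=> i j _ _; exact: f_inj.
by rewrite lerDl sumr_ge0.
Qed.

Section grid.
Context (R : realType) (d : nat).
Local Notation X := ('rV[R]_d).
Local Notation L := (@lebesgue_rV R d).
Variables (h t u : R) (M : nat) (K : finType) (pos : K -> {ffun 'I_d -> 'I_M}).
Hypothesis d_gt0 : (0 < d)%N.
Hypothesis h01 : 0 < h <= 1.
Hypothesis tu : 0 < t <= u.
Hypothesis hM : 1 <= 4 * h * M%:R.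
Hypothesis pos_inj : injective pos.

Local Notation cells := {ffun 'I_d -> 'I_M}.

Definition grid_filler_mass : R := #|cells|%:R * (u * h ^+ d).
Definition grid_island_mass : R := #|K|%:R * (t * h ^+ d).
Local Notation fmass := grid_filler_mass.
Local Notation imass := grid_island_mass.
Hypothesis mass_le : fmass + imass <= 2^-1.

(* [None] is the bulk, [inl k] the filler and [inr k] the island of a cell. *)
Definition grid_corner (j : option (cells + K)) (l : 'I_d) : R :=
  match j with
  | None => - 2
  | Some (inl k) => 4 * h * (k l)%:R
  | Some (inr k) => 4 * h * (pos k l)%:R + 2 * h
  end.

Definition grid_side (j : option (cells + K)) : R := if j is None then 1 else h.

Definition grid_height (j : option (cells + K)) : R :=
  match j with
  | None => 1 - (fmass + imass)
  | Some (inl _) => u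
  | Some (inr _) => t
  end.

Local Notation Q j := (cube (grid_corner j) (grid_side j)).

Let h0 : 0 < h. Proof. by have /andP[] := h01. Qed.
Let h1 : h <= 1. Proof. by have /andP[] := h01. Qed.
Let t0 : 0 < t. Proof. by have /andP[] := tu. Qed.
Let u0 : 0 < u. Proof. by have /andP[t_gt0] := tu; exact: lt_le_trans. Qed.

Lemma grid_side_gt0 j : 0 < grid_side j.
Proof. by case: j => //; rewrite ltr01. Qed.

Let fmass0 : 0 <= fmass.
Proof. by rewrite /fmass !mulr_ge0 ?exprn_ge0 ?(ltW h0) ?(ltW u0). Qed.

Let imass0 : 0 <= imass.
Proof. by rewrite /imass !mulr_ge0 ?exprn_ge0 ?(ltW h0) ?(ltW t0). Qed.

Lemma grid_height_gt0 j : 0 < grid_height j.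
Proof. by case: j => [[k|k]|]//=; have := mass_le; lra. Qed.

Let cell_gap (a b : nat) : a != b ->
  4 * h * a%:R + 4 * h <= 4 * h * b%:R \/ 4 * h * b%:R + 4 * h <= 4 * h * a%:R.
Proof.
have h40 : 0 <= 4 * h by rewrite mulr_ge0// ltW.
by move=> /(nat_gap R)[H|H]; [left|right]; rewrite -[X in _ + X]mulr1 -mulrDr ler_wpM2l.
Qed.

Let cell_ge0 (a : nat) : 0 <= 4 * h * a%:R.
Proof. by rewrite !mulr_ge0// ltW. Qed.

Let ler_dist_l (a b : R) : h <= a - b -> h <= `|a - b|.
Proof. by move/le_trans; apply; exact: ler_norm. Qed.

Let ler_dist_r (a b : R) : h <= b - a -> h <= `|a - b|.
Proof. by rewrite distrC; exact: ler_dist_l. Qed.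

(** The bulk ends at -1 and the grid starts at 0 in every coordinate, a gap of 1, hence of [h]. A
    coordinate exists because [d_gt0]. *)
Let sep_bulk s x y : Q None x -> Q (Some s) y -> exists l, h <= `|x ord0 l - y ord0 l|.
Proof.
move=> Qx Qy; exists (Ordinal d_gt0); apply: ler_dist_r.
have /= := Qx (Ordinal d_gt0); have /= := Qy (Ordinal d_gt0).
by case: s Qy => k _ /=;
  [have := cell_ge0 (k (Ordinal d_gt0))|have := cell_ge0 (pos k (Ordinal d_gt0))];
  have := h1; have := h0; move=> + + + /andP[? _] /andP[_ ?]; lra.
Qed.

Let sep_cells (a b : nat) (x y r : R) : a != b ->
  4 * h * a%:R + r <= x <= 4 * h * a%:R + r + h ->
  4 * h * b%:R + r <= y <= 4 * h * b%:R + r + h -> h <= `|x - y|.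
Proof.
move=> /cell_gap[H|H] /andP[? ?] /andP[? ?]; [apply: ler_dist_r|apply: ler_dist_l];
  have := h0; lra.
Qed.

(** In each coordinate a cell of length [4 h] has its filler in the first quarter and its island in
    the third, so the two empty quarters separate them, within a cell as well as across cells. *)
Let sep_filler_island (a b : nat) (x y : R) :
  4 * h * a%:R <= x <= 4 * h * a%:R + h ->
  4 * h * b%:R + 2 * h <= y <= 4 * h * b%:R + 2 * h + h -> h <= `|x - y|.
Proof.
have [->|/cell_gap[H|H]] := eqVneq a b => /andP[? ?] /andP[? ?];
  [apply: ler_dist_r|apply: ler_dist_r|apply: ler_dist_l]; have := h0; lra.
Qed.

Let ffun_neq (k k' : cells) : k != k' -> exists l, (k l : nat) != k' l.
Proof.
move=> kk; apply/existsP; apply: contraR kk => /existsPn H.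
by apply/eqP/ffunP => l; have := H l; rewrite negbK => /eqP /val_inj.
Qed.

Lemma grid_sep i j x y : Q i x -> Q j y -> i != j ->
  exists l, h <= `|x ord0 l - y ord0 l|.
Proof.
case: i j => [i|] [j|]; last 1 first.
- by rewrite eqxx.
- case: i j => [k|k] [k'|k'] Qx Qy kk.
  + have [|l kl] := @ffun_neq k k'; first by apply: contra kk => /eqP ->.
    exists l; apply: (@sep_cells (k l) (k' l) _ _ 0) => //; rewrite addr0.
      exact: (Qx l).
    exact: (Qy l).
  + by exists (Ordinal d_gt0); exact: sep_filler_island (Qx _) (Qy _).
  + exists (Ordinal d_gt0); rewrite distrC.
    exact: sep_filler_island (Qy _) (Qx _).
  + have [|l kl] := @ffun_neq (pos k) (pos k').
      by apply: contra kk => /eqP/pos_inj ->.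
    exists l; exact: (sep_cells kl (Qx l) (Qy l)).
- move=> Qx Qy _; have [l] := sep_bulk Qy Qx; exists l.
  by rewrite distrC.
- by move=> Qx Qy _; exact: sep_bulk Qx Qy.
Qed.

Let grid_disjoint i j x : Q i x -> Q j x -> i = j.
Proof. exact: (cube_disjoint h0 grid_sep). Qed.

Definition grid_density (x : X) : R := \sum_j grid_height j * \1_(Q j) x.

Lemma measurable_grid_density : measurable_fun [set: X] grid_density.
Proof.
apply: measurable_sum_indic; first exact: (fun j => measurable_cube _ _).
Qed.

Lemma grid_density_ge0 x : 0 <= grid_density x.
Proof.
apply: sumr_ge0 => j _; rewrite mulr_ge0//; exact/ltW/grid_height_gt0.
Qed.

Lemma sum_grid (F : option (cells + K) -> R) :
  \sum_j F j = F None + \sum_k F (Some (inl k)) + \sum_k F (Some (inr k)).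
Proof.
rewrite (bigD1 None)//= -addrA; congr (_ + _).
rewrite (reindex_omap Some id)/=; last by case.
rewrite (eq_bigl xpredT); last by move=> j; rewrite eqxx.
by rewrite big_sumType.
Qed.

Let sum_fillers : \sum_(k : cells) u * h ^+ d = fmass.
Proof. by rewrite /fmass sumr_const mulr_natl. Qed.

Let sum_islands : \sum_(k : K) t * h ^+ d = imass.
Proof. by rewrite /imass sumr_const mulr_natl. Qed.

Lemma grid_density_int : (\int[L]_x (grid_density x)%:E = 1)%E.
Proof.
rewrite (integral_sum_indic _ (fun j => measurable_cube _ _))//; last first.
  by move=> j; exact/ltW/grid_height_gt0.
rewrite (eq_bigr (fun j => (grid_height j * grid_side j ^+ d)%:E)); last first.
  move=> j _; rewrite setIT EFinM; congr (_ * _)%E.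
  exact/lebesgue_cube/ltW/grid_side_gt0.
rewrite sumEFin sum_grid /= sum_fillers sum_islands expr1n mulr1.
by congr EFin; ring.
Qed.

Let island (k : K) : set X := Q (Some (inr k)).

Let measurable_island k : measurable (island k).
Proof. exact: measurable_cube. Qed.

Let island_disjoint j k x : island j x -> island k x -> j = k.
Proof. by move=> Qj Qk; have [] := grid_disjoint Qj Qk. Qed.

Let e01 : 0 <= h ^+ 2 <= 1.
Proof. by rewrite sqr_ge0 expr_le1// ltW. Qed.

Definition grid_data (v : {ffun K -> bool}) : pair_data R d :=
  cell_data measurable_grid_density grid_density_ge0 grid_density_int
    measurable_island island_disjoint e01 v.

Definition grid_eps (v : {ffun K -> bool}) (j : option (cells + K)) : R :=
  if j is Some (inr k) then h ^+ 2 * label (v k) else 0.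

Lemma grid_etaE v j x : Q j x -> pd_eta (grid_data v) x = grid_eps v j.
Proof.
case: j => [[k|k]|] Qx /=.
- by rewrite cell_eta_out// => k' Qx'; have := grid_disjoint Qx Qx'.
- exact: (cell_eta_in _ island_disjoint).
- by rewrite cell_eta_out// => k' Qx'; have := grid_disjoint Qx Qx'.
Qed.

Lemma grid_epsE v j : grid_eps v j = 0 \/ `|grid_eps v j| = h ^+ 2.
Proof.
case: j => [[k|k]|] /=; [by left|right|by left].
by rewrite normrM /label ger0_norm ?sqr_ge0//; case: (v k); rewrite ?normrN normr1 mulr1.
Qed.

(** [minimax_ge] with [e = h ^+ 2] and [p = t * h ^+ d], so that [e ^+ 2 * p] is
    [t * h ^+ (d + 4)]. *)
Lemma grid_minimax_ge (S : set (model R d)) N :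
  N%:R * (t * h ^+ (d + 4)) <= 4^-1 -> (forall v, S (pair_model (grid_data v))) ->
  ((h ^+ 2 * imass / 8)%:E <= minimax_excess_risk S N)%E.
Proof.
move=> Nt Sv; rewrite /imass [_ * (_%:R * _)]mulrA.
apply: minimax_ge Sv => //; last first.
  by move: Nt; rewrite exprD -exprM; congr (_ <= _); ring.
move=> k; rewrite (eq_integral (cst t%:E)); last first.
  move=> x; rewrite inE => Qx; congr EFin.
  exact: (@sum_indic_in _ _ _ (fun j => Q j) grid_disjoint _ (Some (inr k))).
rewrite integral_cst; last exact: measurable_cube.
rewrite EFinM; congr (_ * _)%E; apply: lebesgue_cube; exact: ltW.
Qed.


(** At scales up to 8 sides the cube containing [x] suffices: [s] is cut down to at most the side,
    which loses at most a factor 8. *)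
Let own_mass j x s : Q j x -> 0 < s <= 1 -> s <= 8 * grid_side j ->
  8^-1 ^+ d * grid_height j * s ^+ d <=
  grid_height j * cube_vol (grid_corner j) (grid_side j) (sup_ball x s).
Proof.
move=> Qx /andP[s0 s1] s8; have w0 := grid_side_gt0 j.
pose s' := Num.min s (grid_side j).
have s'0 : 0 <= s' by rewrite le_min !ltW.
have s'w : 0 <= s' <= grid_side j by rewrite s'0 ge_min lexx orbT.
rewrite mulrAC -exprMn [leLHS]mulrC ler_wpM2l ?(ltW (grid_height_gt0 j))//.
apply: (@le_trans _ _ (s' ^+ d)).
  rewrite lerXn2r ?nnegrE ?mulr_ge0// ?(ltW s0)// /s' le_min.
  by apply/andP; split; lra.
apply: (le_trans (cube_vol_ge s'w Qx)); apply: cube_vol_mono; first exact: ltW.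
- exact: measurable_sup_ball.
- exact: measurable_sup_ball.
have s's : s' <= s by rewrite ge_min lexx.
by move=> y /= xy l; have /= := xy l; move=> /andP[? ?]; apply/andP; split; lra.
Qed.

(** About [s / (4 h)] cells per axis fit within distance [s] of [x], after shifting the window
    inwards near the border. Their fillers have total mass [u * (n h) ^+ d], and
    [n h > s / 4 - h > s / 8] since [s > 8 h]. *)
Let filler_mass (k : 'I_d -> 'I_M) (x : X) s : 8 * h < s <= 1 ->
  (forall l, 4 * h * (k l)%:R <= x ord0 l <= 4 * h * (k l)%:R + 3 * h) ->
  8^-1 ^+ d * u * s ^+ d <=
  \sum_(c : cells) u * cube_vol (grid_corner (Some (inl c))) h (sup_ball x s).
Proof.
move=> /andP[hs s1] xk; have h_gt0 := h0.
pose n := Num.truncn (s / (4 * h)).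
have h4 : 0 < 4 * h by rewrite mulr_gt0.
have /andP[n_le n_gt] : n%:R <= s / (4 * h) < n.+1%:R.
  by apply: truncn_itv; rewrite divr_ge0// ltW// (lt_trans _ hs)// mulr_gt0.
have n_leE : 4 * h * n%:R <= s by rewrite mulrC -ler_pdivlMr.
have n_gtE : s < 4 * h * n%:R + 4 * h.
  by move: n_gt; rewrite ltr_pdivrMr// -natr1 mulrDl mul1r mulrC.
(* By [hM] the grid spans at least unit length, so the window for a scale [s <= 1] fits into it. *)
have nM : (n <= M)%N.
  rewrite -(ler_nat R) -(ler_pM2l h4); apply: (le_trans n_leE).
  exact: le_trans s1 hM.
have n0 : (0 < n)%N.
  rewrite lt0n; apply/eqP => n0; move: n_gtE; rewrite n0 mulr0; lra.
pose a l := minn (k l) (M - n).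
have aM (p : {ffun 'I_d -> 'I_n}) l : (a l + p l < M)%N.
  exact: window_lt.
pose psi (p : {ffun 'I_d -> 'I_n}) : cells := [ffun l => Ordinal (aM p l)].
have psi_inj : injective psi.
  move=> p p' /ffunP pp; apply/ffunP => l; apply: val_inj.
  by have := pp l; rewrite !ffunE => -[] /addnI.
have sub p : Q (Some (inl (psi p))) `<=` sup_ball x s.
  move=> y /= Qy l; have /andP[x1 x2] := xk l.
  have := Qy l; rewrite /= ffunE /= => /andP[y1 y2].
  have H1 : (a l + p l + 1 <= k l + n)%N.
    exact: window_le.
  have H2 : (k l + 1 <= a l + p l + n)%N.
    exact: window_ge.
  have R1 : 4 * h * (a l + p l)%:R + 4 * h <= 4 * h * (k l)%:R + 4 * h * n%:R.
    have := H1; rewrite -(ler_nat R) => /(ler_wpM2l (ltW h4)).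
    by rewrite (natrD _ _ 1) (natrD _ _ n) !mulrDr mulr1.
  have R2 : 4 * h * (k l)%:R + 4 * h <= 4 * h * (a l + p l)%:R + 4 * h * n%:R.
    have := H2; rewrite -(ler_nat R) => /(ler_wpM2l (ltW h4)).
    by rewrite (natrD _ _ 1) (natrD _ _ n) !mulrDr mulr1.
  by apply/andP; split; lra.
apply: (@le_trans _ _ (\sum_(p : {ffun 'I_d -> 'I_n}) u * h ^+ d)).
  have -> : \sum_(p : {ffun 'I_d -> 'I_n}) u * h ^+ d = u * (n%:R * h) ^+ d.
    by rewrite sumr_const card_ffun !card_ord -[LHS]mulr_natl natrX exprMn; ring.
  have s0 : 0 <= s by rewrite (le_trans _ (ltW hs))// mulr_ge0// ltW.
  rewrite mulrAC -exprMn mulrC ler_wpM2l ?(ltW u0)//.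
  rewrite lerXn2r ?nnegrE ?mulr_ge0 ?(ltW h_gt0)//.
  by move: n_gtE hs; rewrite [n%:R * h]mulrC; lra.
rewrite (eq_bigr (fun p => u * cube_vol (grid_corner (Some (inl (psi p)))) h
    (sup_ball x s))); last first.
  move=> p _; congr (_ * _); apply/esym/cube_vol_id.
  - exact: ltW.
  - exact: measurable_sup_ball.
  - exact: sub.
pose F (c : cells) := u * cube_vol (grid_corner (Some (inl c))) h (sup_ball x s).
apply: (ler_sum_inj (F := F) psi_inj) => c.
by rewrite mulr_ge0 ?cube_vol_ge0// ltW.
Qed.

(** Small scales use the cube of [x] itself, large ones the fillers, whose height [u] dominates that
    of the islands. The bulk has side 1, so it is always in the first case. *)
Lemma grid_mass j x s : Q j x -> 0 < s <= 1 ->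
  8^-1 ^+ d * grid_height j * s ^+ d <=
  \sum_i grid_height i * cube_vol (grid_corner i) (grid_side i) (sup_ball x s).
Proof.
move=> Qx s01; have h_gt0 := h0.
have F0 i : 0 <= grid_height i * cube_vol (grid_corner i) (grid_side i) (sup_ball x s).
  by rewrite mulr_ge0 ?cube_vol_ge0// ltW// grid_height_gt0.
have [s8|s8] := leP s (8 * grid_side j).
  apply: (le_trans (own_mass Qx s01 s8)).
  by rewrite (bigD1 j)//= lerDl sumr_ge0.
have /andP[s0 s1] := s01.
case: j Qx s8 => [j|] Qx s8; last by exfalso; move: s8; rewrite /=; lra.
have [k xk] : exists k : 'I_d -> 'I_M,
    forall l, 4 * h * (k l)%:R <= x ord0 l <= 4 * h * (k l)%:R + 3 * h.
  case: j Qx s8 => k Qx _; [exists k|exists (pos k)] => l;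
    by have /= /andP[? ?] := Qx l; apply/andP; split; lra.
have hs : 8 * h < s <= 1 by rewrite s8.
apply: (@le_trans _ _ (8^-1 ^+ d * u * s ^+ d)).
  rewrite ler_wpM2r ?exprn_ge0 ?(ltW s0)// ler_wpM2l ?exprn_ge0//.
  by have /andP[_ tu'] := tu; case: j {Qx s8}.
apply: (le_trans (filler_mass hs xk)); rewrite sum_grid -addrA [leRHS]addrCA.
by rewrite lerDl addr_ge0// sumr_ge0.
Qed.

Variables (alpha beta G : R).
Hypotheses (alpha_gt0 : 0 < alpha) (beta_gt0 : 0 < beta) (G0 : 0 <= G).
Hypothesis island_margin : imass <= G * (h ^+ 2) `^ alpha.
Hypothesis island_tail : imass <= G * t `^ beta.
Hypothesis filler_tail : fmass <= G * u `^ beta.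

Lemma grid_tail s : 0 < s ->
  \sum_(j | grid_height j <= s) grid_height j * grid_side j ^+ d <=
  (2 `^ beta + (G + G)) * s `^ beta.
Proof.
move=> s0; rewrite big_mkcond sum_grid/= expr1n mulr1.
have p0 (x : R) : 0 <= x `^ beta by exact: powR_ge0.
have mono x : 0 < x -> x <= s -> x `^ beta <= s `^ beta.
  move=> x0 xs; apply: ge0_ler_powR; rewrite ?nnegrE//; exact: ltW.
rewrite mulrDl mulrDl [in X in _ <= X]addrA; apply: lerD; first apply: lerD.
- case: ifPn => bs; last by rewrite mulr_ge0.
  rewrite -powRM ?(ltW s0)//.
  apply: (@le_trans _ _ 1); first by have := fmass0; have := imass0; lra.
  apply: (@le_trans _ _ (1 `^ beta)); first by rewrite powR1.
  apply: ge0_ler_powR; rewrite ?nnegrE ?mulr_ge0 ?(ltW s0) ?(ltW beta_gt0)//.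
  by move: bs; have := mass_le; lra.
- have [us|us] := leP u s; last by rewrite big1 ?mulr_ge0.
  rewrite sum_fillers (le_trans filler_tail)// ler_wpM2l//; exact: mono u0 us.
- have [ts|ts] := leP t s; last by rewrite big1 ?mulr_ge0.
  rewrite sum_islands (le_trans island_tail)// ler_wpM2l//; exact: mono t0 ts.
Qed.

Lemma grid_margin v : \sum_(j | grid_eps v j != 0) grid_height j * grid_side j ^+ d <=
  G * (h ^+ 2) `^ alpha.
Proof.
apply: le_trans island_margin.
rewrite big_mkcond sum_grid/= eqxx/= big1_eq !add0r.
rewrite -sum_islands; apply: ler_sum => k _; case: ifP => // _.
by rewrite mulr_ge0 ?exprn_ge0 ?(ltW t0) ?(ltW h0).
Qed.

Variables (nrm : X -> R) (nrm_norm : is_norm nrm).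
Variables (C1 C2 : R) (C1_gt0 : 0 < C1) (C2_gt0 : 0 < C2).
Hypothesis nrm_coord : forall (x : X) i, `|x ord0 i| <= C1 * nrm x.
Hypothesis nrm_le : forall (x : X) s, 0 <= s ->
  (forall i, `|x ord0 i| <= s) -> nrm x <= C2 * s.

Lemma grid_lower_bound Ca Cb Cc Cd D0 N : G <= Ca -> 2 `^ beta + (G + G) <= Cb ->
  2 * C1 ^+ 2 <= Cc -> 0 < Cd <= 8^-1 ^+ d / (4 * C1 * C2) ^+ d ->
  0 < D0 <= 2 * C2 -> N%:R * (t * h ^+ (d + 4)) <= 4^-1 ->
  ((h ^+ 2 * imass / 8)%:E <= minimax_excess_risk
    [set m : model R d | assumptions nrm alpha beta Ca Cb Cc Cd D0 m] N)%E.
Proof.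
move=> GCa BCb CCc Cdk D0C Nt; apply: grid_minimax_ge => // v /=.
have fE x : pd_f (grid_data v) x = \sum_j grid_height j * \1_(Q j) x by [].
exact: (cube_model_assumptions grid_side_gt0 grid_height_gt0 fE (@grid_etaE v)
  h0 grid_sep (grid_epsE v) nrm_norm C1_gt0 C2_gt0 nrm_coord nrm_le G0 alpha_gt0
  (grid_margin v) grid_tail grid_mass GCa BCb CCc Cdk D0C).
Qed.

End grid.

(** * Choice of the parameters *)

Lemma powR_le1 (R : realType) (x r : R) : 0 < x <= 1 -> 0 <= r -> x `^ r <= 1.
Proof.
move=> /andP[x0 x1] r0; apply: (@le_trans _ _ (1 `^ r)); last by rewrite powR1.
by apply: ge0_ler_powR => //; rewrite nnegrE ?ler01// ltW.
Qed.

Lemma powR_ge1 (R : realType) (x r : R) : 1 <= x -> 0 <= r -> 1 <= x `^ r.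
Proof.
move=> x1 r0; apply: (@le_trans _ _ (1 `^ r)); first by rewrite powR1.
by apply: ge0_ler_powR => //; rewrite nnegrE ?ler01// (le_trans ler01).
Qed.

Lemma expr_mono (R : realFieldType) (x y : R) n : 0 <= x -> x <= y -> x ^+ n <= y ^+ n.
Proof. by move=> x0 xy; apply: lerXn2r; rewrite ?nnegrE ?(le_trans x0 xy). Qed.

Section rates.
Context (R : realType) (d : nat) (nrm : 'rV[R]_d -> R).
Local Notation X := ('rV[R]_d).
Hypotheses (d_gt0 : (0 < d)%N) (nrm_norm : is_norm nrm).
Variables (C1 C2 : R) (C1_gt0 : 0 < C1) (C2_gt0 : 0 < C2).
Hypothesis nrm_coord : forall (x : X) i, `|x ord0 i| <= C1 * nrm x.
Hypothesis nrm_le : forall (x : X) s, 0 <= s ->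
  (forall i, `|x ord0 i| <= s) -> nrm x <= C2 * s.
Variables (alpha beta : R).
Hypotheses (alpha_gt0 : 0 < alpha) (beta_gt0 : 0 < beta).

(* The step count [M] satisfies [M h <= 2], so fillers of this height weigh at
   most [1 / 4]. *)
Definition filler_height : R := (4 * 2 ^+ d)^-1.
(** The first term bounds the island mass against [t]^ beta[when the grid is rounded up by a factor
    at most 2 per axis; the second bounds a filler mass of 1/4 against]filler_height [^ beta]. *)
Definition grid_const : R := 2 ^+ d + 4^-1 / filler_height `^ beta.
Local Notation u0 := filler_height.
Local Notation G := grid_const.

Variables (Ca Cb Cc Cd D0 : R).
Hypotheses (CaG : G <= Ca) (CbG : 2 `^ beta + (G + G) <= Cb)
  (CcG : 2 * C1 ^+ 2 <= Cc) (CdG : 0 < Cd <= 8^-1 ^+ d / (4 * C1 * C2) ^+ d)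
  (D0G : 0 < D0 <= 2 * C2).

Local Notation minimax N := (minimax_excess_risk
  [set m : model R d | assumptions nrm alpha beta Ca Cb Cc Cd D0 m] N).

Let u0_gt0 : 0 < u0.
Proof. by rewrite invr_gt0 mulr_gt0// exprn_gt0. Qed.

Let G_ge2 : 2 ^+ d <= G.
Proof. by rewrite lerDl divr_ge0// ?powR_ge0// invr_ge0. Qed.

Let G_ge0 : 0 <= G.
Proof. by apply: le_trans G_ge2; rewrite exprn_ge0. Qed.

Let G_ge1 : 1 <= G.
Proof. by apply: le_trans G_ge2; rewrite exprn_ege1// ler1n. Qed.

Lemma ceil_between (y : R) : 1 <= y ->
  exists M : nat, y <= M%:R <= 2 * y.
Proof.
move=> y1; exists (Num.truncn y).+1.
have /andP[] := truncn_itv (le_trans ler01 y1).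
by rewrite -natr1; move=> ? ?; apply/andP; split; lra.
Qed.

Lemma card_cells M : #|{ffun 'I_d -> 'I_M}|%:R = M%:R ^+ d :> R.
Proof. by rewrite card_ffun !card_ord natrX. Qed.

(** An island mass of order [t]^ beta[takes a volume]V = t [^ (beta - 1)], at least 1 as
    [beta <= 1]. The grid is therefore enlarged until [(M h) ^+ d] lies between [V] and
    [2 ^+ d * V]. Every cell carries an island, and the fillers have the same height [t]. *)
Lemma low_bound N h t : beta <= 1 -> 0 < h <= 1 -> 0 < t <= 1 ->
  t `^ beta <= (h ^+ 2) `^ alpha -> 2 ^+ d * t `^ beta <= 4^-1 ->
  N%:R * (t * h ^+ (d + 4)) <= 4^-1 ->
  ((h ^+ 2 * t `^ beta / 8)%:E <= minimax N)%E.
Proof.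
move=> beta1 h01 /andP[t0 t1] th tmass Nt.
have /andP[h0 h1] := h01.
pose V := t `^ (beta - 1).
have V1 : 1 <= V.
  rewrite /V -[beta - 1]opprB powRN invf_ge1 ?powR_gt0//.
  by rewrite powR_le1 ?subr_ge0 ?t0.
have Vt : V * t = t `^ beta.
  rewrite /V -[X in _ * X](powRr1 (ltW t0)) -powRD ?subrK//.
  by rewrite (gt_eqF t0) implybT.
pose y := V `^ (d%:R^-1) / h.
have Vd1 : 1 <= V `^ (d%:R^-1).
  by rewrite powR_ge1// invr_ge0.
have y1 : 1 <= y.
  rewrite ler_pdivlMr// mul1r; exact: le_trans Vd1.
have [M /andP[yM My]] := ceil_between y1.
have yh : (y * h) ^+ d = V.
  rewrite /y divfK ?gt_eqF// -powR_mulrn ?powR_ge0// -powRrM mulVf ?powRr1//.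
    exact: le_trans V1.
  by rewrite pnatr_eq0 -lt0n.
have VM : V <= (M%:R * h) ^+ d.
  rewrite -yh; apply: expr_mono; first by rewrite mulr_ge0 ?(ltW h0) ?(le_trans ler01 y1).
  by rewrite ler_wpM2r// ltW.
have MV : (M%:R * h) ^+ d <= 2 ^+ d * V.
  rewrite -yh -exprMn; apply: expr_mono; first by rewrite mulr_ge0 ?(ltW h0).
  by rewrite mulrA ler_wpM2r// ltW.
have hM : 1 <= 4 * h * M%:R.
  have : 1 <= h * M%:R.
    apply: (le_trans Vd1); rewrite mulrC -ler_pdivrMr//.
  by lra.
have imE : grid_island_mass d h t {ffun 'I_d -> 'I_M} = (M%:R * h) ^+ d * t.
  by rewrite /grid_island_mass card_cells exprMn; ring.
have fmE : grid_filler_mass d h t M = (M%:R * h) ^+ d * t.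
  by rewrite /grid_filler_mass card_cells exprMn; ring.
have im_ge : t `^ beta <= (M%:R * h) ^+ d * t by rewrite -Vt ler_wpM2r// ltW.
have im_le : (M%:R * h) ^+ d * t <= 2 ^+ d * t `^ beta.
  by rewrite -Vt [leRHS]mulrA ler_wpM2r// ltW.
have im_leG : (M%:R * h) ^+ d * t <= G * t `^ beta.
  by apply: (le_trans im_le); rewrite ler_wpM2r ?powR_ge0.
apply: (@le_trans _ _ (h ^+ 2 * grid_island_mass d h t {ffun 'I_d -> 'I_M} / 8)%:E).
  by rewrite lee_fin ler_wpM2r// ler_wpM2l ?sqr_ge0// imE.
apply: (grid_lower_bound (u := t) (M := M) (pos := id) d_gt0 h01 _ hM _ _
  alpha_gt0 beta_gt0 G_ge0 _ _ _ nrm_norm C1_gt0 C2_gt0 nrm_coord nrm_le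
  CaG CbG CcG CdG D0G Nt) => //; rewrite ?imE ?fmE//.
- by rewrite t0 lexx.
- lra.
- by apply: (le_trans im_leG); rewrite ler_wpM2l.
Qed.

(** Now [V <= 1], so the grid has about unit size, the fillers have constant height, and only [m],
    the integer part of [V / h ^+ d], of the cells carry islands. The hypothesis on [h ^+ d] gives
    [m >= 1]; rounding down then loses at most a factor 2, so 16 replaces 8. *)
Lemma high_bound N h t : 1 <= beta -> 0 < h <= 1 -> 0 < t <= u0 ->
  t `^ beta <= (h ^+ 2) `^ alpha -> t `^ beta <= 4^-1 ->
  h ^+ d <= t `^ (beta - 1) -> N%:R * (t * h ^+ (d + 4)) <= 4^-1 ->
  ((h ^+ 2 * t `^ beta / 16)%:E <= minimax N)%E.
Proof.
move=> beta1 h01 /andP[t0 tu0] th tmass ht Nt.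
have /andP[h0 h1] := h01.
pose V := t `^ (beta - 1).
have u01 : u0 <= 1.
  by rewrite invf_le1 ?mulr_gt0 ?exprn_gt0// mulr_ege1 ?exprn_ege1 ?ler1n.
have t1 : t <= 1 by exact: le_trans u01.
have V1 : V <= 1.
  by rewrite powR_le1 ?subr_ge0 ?t0.
have Vt : V * t = t `^ beta.
  rewrite /V -[X in _ * X](powRr1 (ltW t0)) -powRD ?subrK//.
  by rewrite (gt_eqF t0) implybT.
have y1 : 1 <= h^-1 by rewrite invf_ge1.
have [M /andP[yM My]] := ceil_between y1.
have hM1 : 1 <= M%:R * h by rewrite -ler_pdivrMr// mul1r.
have hM2 : M%:R * h <= 2 by rewrite -ler_pdivlMr.
have hM : 1 <= 4 * h * M%:R by lra.
have hd0 : 0 < h ^+ d by rewrite exprn_gt0.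
pose Y := V / h ^+ d.
have Y1 : 1 <= Y by rewrite ler_pdivlMr// mul1r.
pose m := Num.truncn Y.
have /andP[mY Ym] := truncn_itv (le_trans ler01 Y1).
have mY2 : Y / 2 <= m%:R.
  have m1 : (1 <= m)%N.
    by rewrite -ltnS -(ltr_nat R); apply: le_lt_trans Ym.
  by move: m1 Ym; rewrite -(ler_nat R) -natr1 -/m; lra.
have mM : (m <= #|{ffun 'I_d -> 'I_M}|)%N.
  rewrite -(ler_nat R) card_cells; apply: (le_trans mY).
  rewrite ler_pdivrMr// -exprMn; apply: (le_trans V1).
  by rewrite exprn_ege1.
pose pos (i : 'I_m) : {ffun 'I_d -> 'I_M} := enum_val (widen_ord mM i).
have pos_inj : injective pos.
  by move=> i j /enum_val_inj /(congr1 val) /= ij; exact: val_inj.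
have imE : grid_island_mass d h t 'I_m = m%:R * h ^+ d * t.
  by rewrite /grid_island_mass card_ord; ring.
have fmE : grid_filler_mass d h u0 M = (M%:R * h) ^+ d * u0.
  by rewrite /grid_filler_mass card_cells exprMn; ring.
have fm_le : (M%:R * h) ^+ d * u0 <= 4^-1.
  rewrite ler_pdivrMr ?mulr_gt0 ?exprn_gt0// mulKf ?pnatr_eq0//.
  by apply: expr_mono => //; rewrite mulr_ge0 ?(ltW h0).
have im_ge : t `^ beta / 2 <= m%:R * h ^+ d * t.
  rewrite -Vt mulrAC ler_wpM2r ?(ltW t0)// -ler_pdivrMr//.
  by rewrite mulrAC.
have im_le : m%:R * h ^+ d * t <= t `^ beta.
  by rewrite -Vt ler_wpM2r ?(ltW t0)// -ler_pdivlMr.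
have im_leG : m%:R * h ^+ d * t <= G * t `^ beta.
  by apply: (le_trans im_le); rewrite ler_peMl ?powR_ge0.
apply: (@le_trans _ _ (h ^+ 2 * grid_island_mass d h t 'I_m / 8)%:E).
  rewrite lee_fin imE.
  have : h ^+ 2 * (t `^ beta / 2) <= h ^+ 2 * (m%:R * h ^+ d * t).
    by rewrite ler_wpM2l ?sqr_ge0.
  by lra.
apply: (grid_lower_bound (u := u0) (M := M) (pos := pos) d_gt0 h01 _ hM pos_inj _
  alpha_gt0 beta_gt0 G_ge0 _ _ _ nrm_norm C1_gt0 C2_gt0 nrm_coord nrm_le
  CaG CbG CcG CdG D0G Nt); rewrite ?imE ?fmE//.
- by rewrite t0.
- lra.
- by apply: (le_trans im_leG); rewrite ler_wpM2l.
- apply: (le_trans fm_le).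
  rewrite mulrDl divfK ?gt_eqF ?powR_gt0// lerDr.
  by rewrite mulr_ge0 ?powR_ge0 ?exprn_ge0.
Qed.

End rates.

Lemma powR_decay (R : realType) (k e : R) : 0 < k -> 0 < e ->
  \forall N \near \oo, (4 * N%:R) `^ (- k) <= e.
Proof.
move=> k0 e0; near=> N.
have N_ge : e `^ (- k^-1) <= N%:R by near: N; exact: nbhs_infty_ger.
have eN : e^-1 <= (4 * N%:R) `^ k.
  rewrite -(powR_inv1 (ltW e0)) -[X in e `^ (- X)](mulVf (lt0r_neq0 k0)) -mulNr powRrM.
  apply: ge0_ler_powR; rewrite ?nnegrE ?powR_ge0 ?mulr_ge0 ?(ltW k0)//.
  by apply: (le_trans N_ge); rewrite ler_peMl// ler1n.
rewrite powRN -[leRHS]invrK lef_pV2// posrE ?invr_gt0//.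
by apply: lt_le_trans eN; rewrite invr_gt0.
Unshelve. all: by end_near. Qed.

Theorem theorem2 (R : realType) (d : nat) (d_gt0 : (0 < d)%N)
    (nrm : 'rV[R]_d -> R) (nrm_norm : is_norm nrm)
    (alpha beta : R) (alpha_gt0 : 0 < alpha) (beta_gt0 : 0 < beta)
    (alpha_beta : beta * (2 * alpha - d%:R) <= 2 * alpha) :
  exists Ca0 Cb0 Cc0 Cd0 D0 : R, [/\ 0 < Cd0, 0 < D0 &
    forall Ca Cb Cc Cd D : R,
      Ca0 <= Ca -> Cb0 <= Cb -> Cc0 <= Cc -> 0 < Cd <= Cd0 -> 0 < D <= D0 ->
      exists2 c : R, 0 < c &
        \forall N \near \oo,
          ((c * N%:R `^ (- Num.min beta
              (2 * beta * (alpha + 1) /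
               (beta * d%:R + 2 * (alpha + 2 * beta)))))%:E
           <= minimax_excess_risk
                [set m : model R d |
                  assumptions nrm alpha beta Ca Cb Cc Cd D m] N)%E].
Proof.
have [C1 C1_gt0 nrm_coord] := coord_le_is_norm nrm_norm.
have [C2 C2_gt0 nrm_le] := is_norm_le nrm_norm.
pose G := grid_const d beta.
exists G, (2 `^ beta + (G + G)), (2 * C1 ^+ 2),
  (8^-1 ^+ d / (4 * C1 * C2) ^+ d), (2 * C2); split.
- by rewrite divr_gt0 ?exprn_gt0// ?invr_gt0// !mulr_gt0.
- by rewrite mulr_gt0.
move=> Ca Cb Cc Cd D CaG CbG CcG CdG DG.
set E := beta * d%:R + 2 * (alpha + 2 * beta).
have d0 : 0 < d%:R :> R by rewrite ltr0n.
have E_gt0 : 0 < E.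
  by rewrite addr_gt0 ?mulr_gt0 ?addr_gt0 ?mulr_gt0.
set g := Num.min beta _.
(* The power of 4 converts [q = 4 N] into [N], and 16 is the worse of the two constants 8 and 16.
   This factor depends only on [alpha], [beta] and [d]. *)
exists (4 `^ (- g) / 16) => [|]; first by rewrite divr_gt0 ?powR_gt0.
suff : \forall N \near \oo, (((4 * N%:R) `^ (- g) / 16)%:E <=
    minimax_excess_risk [set m : model R d |
      assumptions nrm alpha beta Ca Cb Cc Cd D m] N)%E.
  apply: filterS => N; congr (_ <= _)%E; congr EFin.
  by rewrite powRM//; ring.
pose low := low_bound d_gt0 nrm_norm C1_gt0 C2_gt0 nrm_coord nrm_le alpha_gt0
  beta_gt0 CaG CbG CcG CdG DG.
pose high := high_bound d_gt0 nrm_norm C1_gt0 C2_gt0 nrm_coord nrm_le alpha_gt0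
  beta_gt0 CaG CbG CcG CdG DG.
have p4 : 0 < (4^-1 : R) by rewrite invr_gt0.
have p2d : 0 < (4 * 2 ^+ d)^-1 :> R by rewrite invr_gt0 mulr_gt0// exprn_gt0.
have [gE|gE] := leP beta (2 * beta * (alpha + 1) / E).
  have gb : g = beta by rewrite /g min_l.
  (* If [beta] is the minimum, then [E <= 2 * (alpha + 1)], hence [4 * beta <= 2]. *)
  have beta1 : beta <= 1.
    move: gE; rewrite ler_pdivlMr//.
    rewrite (_ : 2 * beta * _ = beta * (2 * (alpha + 1))); last by ring.
    rewrite ler_pM2l// /E => H.
    have : 0 <= beta * d%:R by rewrite mulr_ge0// ltW.
    by lra.
  rewrite gb; near=> N.
  have q1 : 1 <= 4 * N%:R :> R.
    have : 1 <= N%:R :> R by near: N; exact: nbhs_infty_ger.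
    by lra.
  have q0 : 0 < 4 * N%:R :> R by exact: lt_le_trans q1.
  pose t : R := (4 * N%:R)^-1.
  have tb : t `^ beta = (4 * N%:R) `^ (- beta).
    by rewrite /t -(powR_inv1 (ltW q0)) -powRrM mulN1r.
  have b_le : (4 * N%:R) `^ (- beta) <= (4 * 2 ^+ d)^-1 :> R.
    by near: N; exact: powR_decay.
  have t01 : 0 < t <= 1 by rewrite invr_gt0 q0 invf_le1.
  apply: le_trans (low N 1 t beta1 _ t01 _ _ _).
  - by rewrite lee_fin expr1n mul1r tb; have := powR_ge0 (4 * N%:R : R) (- beta); lra.
  - by rewrite ltr01 lexx.
  - by rewrite expr1n powR1 powR_le1// ltW.
  - by rewrite tb mulrC -ler_pdivlMr ?exprn_gt0// -invfM.
  - rewrite expr1n mulr1 /t invfM mulrCA mulfV ?mulr1// gt_eqF//.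
    by rewrite -(pmulr_rgt0 _ (ltr0n _ 4)).
have gb : g = 2 * beta * (alpha + 1) / E by rewrite /g min_r// ltW.
rewrite gb; near=> N.
have q1 : 1 <= 4 * N%:R :> R.
  have : 1 <= N%:R :> R by near: N; exact: nbhs_infty_ger.
  by lra.
have q0 : 0 < 4 * N%:R :> R by exact: lt_le_trans q1.
have N0 : N%:R != 0 :> R by move: q0; rewrite pmulr_rgt0//; exact: lt0r_neq0.
set q : R := 4 * N%:R in q1 q0 *.
pose h : R := q `^ (- (beta / E)).
pose t : R := q `^ (- (2 * alpha / E)).
have qD x y : q `^ x * q `^ y = q `^ (x + y).
  by rewrite powRD// (gt_eqF q0) implybT.
have qX x n : (q `^ x) ^+ n = q `^ (x * n%:R).
  by rewrite powRrM powR_mulrn// powR_ge0.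
have tb : t `^ beta = q `^ (- (2 * alpha * beta / E)).
  by rewrite /t -powRrM; congr (_ `^ _); ring.
have qle x : 0 <= x -> q `^ (- x) <= 1.
  by move=> x0; rewrite powRN invf_le1 ?powR_gt0// powR_ge1.
(* The margin and tail conditions allow the same island mass: [t] is tuned to [h] so that both are
   saturated. *)
have ha : (h ^+ 2) `^ alpha = t `^ beta.
  by rewrite tb /h qX -powRrM; congr (_ `^ _); ring.
have h01 : 0 < h <= 1.
  by rewrite powR_gt0//= qle// divr_ge0 ?ltW.
have t01 : 0 < t <= 1.
  by rewrite powR_gt0//= qle// divr_ge0 ?mulr_ge0 ?ltW.
(* [E] is the value for which [t * h ^+ (d + 4)] is exactly [1 / q], so equality holds. *)
have Nt : N%:R * (t * h ^+ (d + 4)) <= 4^-1.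
  rewrite /h /t qX qD.
  have -> : - (2 * alpha / E) + - (beta / E) * (d + 4)%:R = - 1.
    by rewrite natrD /E; field; rewrite gt_eqF.
  by rewrite powR_inv1 ?(ltW q0)// /q invfM mulrCA mulfV ?mulr1.
have ht : h ^+ 2 * t `^ beta = q `^ (- (2 * beta * (alpha + 1) / E)).
  by rewrite tb /h qX qD; congr (_ `^ _); ring.
have tb_le : t `^ beta <= (4 * 2 ^+ d)^-1.
  rewrite tb /q; near: N; apply: powR_decay => //.
  by rewrite divr_gt0 ?mulr_gt0.
have t_le : t <= (4 * 2 ^+ d)^-1.
  rewrite /t /q; near: N; apply: powR_decay => //.
  by rewrite divr_gt0 ?mulr_gt0.
have pw : 0 <= q `^ (- (2 * beta * (alpha + 1) / E)) by exact: powR_ge0.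
have [beta1|beta1] := leP beta 1.
  apply: le_trans (low N h t beta1 h01 t01 _ _ Nt).
  - by rewrite lee_fin ht; lra.
  - by rewrite ha.
  - by rewrite mulrC -ler_pdivlMr ?exprn_gt0// -invfM.
apply: le_trans (high N h t (ltW beta1) h01 _ _ _ _ Nt).
- by rewrite lee_fin ht.
- by rewrite t_le andbT; have /andP[] := t01.
- by rewrite ha.
- apply: (le_trans tb_le); rewrite lef_pV2 ?posrE ?mulr_gt0 ?exprn_gt0//.
  by rewrite ler_peMr// exprn_ege1// ler1n.
- rewrite /h qX /t -powRrM; apply: ler_powR => //.
  rewrite (_ : - (beta / E) * _ = - (beta * d%:R) / E); last by ring.
  rewrite (_ : - (2 * alpha / E) * _ = - (2 * alpha * (beta - 1)) / E); last by ring.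
  by rewrite ler_pdivrMr// divfK ?gt_eqF// lerN2; lra.
Unshelve. all: by end_near. Qed.
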